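(* Let $h^-,h^+,h>0$ with $h<h^+$ and $h^--h^++h>0$, let $S=\{z\in\mathbb C:\operatorname{Re}z<0,\ 0<\operatorname{Im}z<\pi/2\}$, and let $\widetilde\Omega$ be the degenerate region defined in the context. Let $D\in\mathbb C$ and let $z^-,z^+$ be points of the open segment $(0,i\pi/2)$ satisfying $$ D+\frac{2h^-z^-}{3\pi}-\frac{2h^+z^+}{3\pi}=0,\qquad h^-z^--h^+z^+=-\frac{ih\pi}{2},\qquad h^-\sinh(2z^-)=h^+\sinh(2z^+). $$ Then the function $$ \widetilde Q(z)=z\left(D+\frac{2h^-z^-}{3\pi}-\frac{2h^+z^+}{3\pi}\right)+\frac{h^-}{\pi}\ln\frac{\sinh(z-z^-)}{\sinh(z+z^-)}-\frac{h^+}{\pi}\ln\frac{\sinh(z-z^+)}{\sinh(z+z^+)}-i(h^--h^+) $$ maps $S$ conformally (biholomorphically) onto $\widetilde\Omega$, where $\ln$ is the branch of the logarithm in the plane cut along the negative imaginary half-line with $\ln 1=0$.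
   Context: $\widetilde\Omega=\widetilde\Omega(h^-,h^+,h)=\{x+iy:-h^-<y<\tilde u(x)\}$, where $\tilde u(x)=0$ for $x<0$, $\tilde u(0)=-(h^--h^++h)$, $\tilde u(x)=-(h^--h^+)$ for $x>0$. (This is the limit as $\delta\to0$ of a channel under a rectangular dam of width $\delta$: its boundary has vertices $w_4=0$, $w_1=-i(h^--h^+)$, and the tip $w_2=w_3=-i(h^--h^++h)$ of a vertical slit.) *)

(* Defs.v *)
From Stdlib Require Import Reals Lra.
From Coquelicot Require Import Coquelicot.
Open Scope R_scope.

Definition Cexp (z : C) : C := (exp (Re z) * cos (Im z), exp (Re z) * sin (Im z)).

Definition Csinh (z : C) : C := ((Cexp z - Cexp (- z)) / 2)%C.

Definition neg_imag_halfline (w : C) : Prop := Re w = 0 /\ Im w <= 0.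

(* The argument of w in (- PI / 2, 3 * PI / 2): it is PI / 2 plus the principal
   argument of w / i = (Im w, - Re w), computed by the half-angle formula
   Arg (a + i b) = 2 * atan (b / (|a + i b| + a)), whose denominator vanishes
   only for w on the cut. *)
Definition arg_cut (w : C) : R := PI / 2 + 2 * atan (- Re w / (Cmod w + Im w)).

(* Values on the cut itself are junk. *)
Definition Cln (w : C) : C := (ln (Cmod w), arg_cut w).

Lemma arg_cut_bound (w : C) : - (PI / 2) < arg_cut w < 3 * (PI / 2).
Proof.
unfold arg_cut.
generalize (atan_bound (- Re w / (Cmod w + Im w))); lra.
Qed.

Lemma Cmod_sqr (w : C) : Cmod w * Cmod w = Re w * Re w + Im w * Im w.
Proof.
unfold Cmod, Re, Im; rewrite sqrt_sqrt; [ring | nra].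
Qed.

Lemma off_cut_pos (w : C) :
  ~ neg_imag_halfline w -> 0 < Cmod w /\ 0 < Cmod w + Im w.
Proof.
intros Hw.
assert (H := Cmod_sqr w); assert (H0 := Cmod_ge_0 w).
assert (Hs : 0 < Cmod w + Im w).
{ destruct (Rlt_or_le 0 (Im w)) as [Hi | Hi]; [lra |].
  assert (Re w <> 0) by (intros E; apply Hw; split; assumption).
  nra. }
split; [| exact Hs].
destruct (Req_dec (Cmod w) 0) as [E | E]; [| lra].
rewrite E in *; nra.
Qed.

Lemma Cexp_Cln (w : C) : ~ neg_imag_halfline w -> Cexp (Cln w) = w.
Proof.
intros Hw.
destruct (off_cut_pos w Hw) as [Hr Hs].
assert (H := Cmod_sqr w).
unfold Cexp, Cln, arg_cut; simpl.
rewrite exp_ln by exact Hr.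
set (r := Cmod w) in *.
destruct w as [x y]; simpl in *.
set (t := atan (- x / (r + y))).
assert (Ht : sin t = - x / (r + y) * cos t).
{ assert (Hc : 0 < cos t) by (unfold t; generalize (atan_bound (- x / (r + y))); intros; apply cos_gt_0; lra).
  assert (E := tan_atan (- x / (r + y))); fold t in E.
  rewrite <- E; unfold tan; field; lra. }
assert (Hx : (r + y) * sin t = - x * cos t) by (rewrite Ht; field; lra).
assert (H1 := sin2_cos2 t); unfold Rsqr in H1.
assert (Hcc : 2 * r * (cos t * cos t) = r + y).
{ assert ((r + y) * (2 * r * (cos t * cos t)) = (r + y) * (r + y)).
  { transitivity ((r + y) * (r + y) * (sin t * sin t + cos t * cos t));
      [| rewrite H1; ring].
    replace ((r + y) * (r + y) * (sin t * sin t + cos t * cos t))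
      with (((r + y) * sin t) * ((r + y) * sin t)
            + (r + y) * (r + y) * (cos t * cos t)) by ring.
    rewrite Hx.
    replace (- x * cos t * (- x * cos t)) with ((r * r - y * y) * (cos t * cos t))
      by (rewrite H; ring).
    ring. }
  nra. }
assert (Hsc : 2 * r * (sin t * cos t) = - x).
{ apply (Rmult_eq_reg_l (r + y)); [| lra].
  replace ((r + y) * (2 * r * (sin t * cos t)))
    with (2 * r * cos t * ((r + y) * sin t)) by ring.
  rewrite Hx.
  replace (2 * r * cos t * (- x * cos t)) with (- x * (2 * r * (cos t * cos t)))
    by ring.
  rewrite Hcc; ring. }
f_equal.
- rewrite cos_plus, cos_PI2, sin_PI2, sin_2a; lra.
- rewrite sin_plus, cos_PI2, sin_PI2, cos_2a_cos; lra.
Qed.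

Lemma Cln_1 : Cln 1 = 0.
Proof.
unfold Cln, arg_cut; rewrite Cmod_1, ln_1; simpl.
replace (- (1) / (1 + 0)) with (- (1)) by field.
rewrite atan_opp, atan_1.
unfold RtoC; f_equal; field.
Qed.

Definition strip (z : C) : Prop := Re z < 0 /\ 0 < Im z < PI / 2.

Definition open_segment_ipi2 (z : C) : Prop := Re z = 0 /\ 0 < Im z < PI / 2.

Definition u_tilde (hm hp h x : R) : R :=
  match total_order_T x 0 with
  | inleft (left _) => 0                        (* x < 0 *)
  | inleft (right _) => - (hm - hp + h)         (* x = 0 *)
  | inright _ => - (hm - hp)                    (* x > 0 *)
  end.

Definition Omega_tilde (hm hp h : R) (w : C) : Prop :=
  - hm < Im w < u_tilde hm hp h (Re w).

Definition Q_tilde (hm hp : R) (D zm zp z : C) : C :=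
  (z * (D + 2 * hm * zm / (3 * PI) - 2 * hp * zp / (3 * PI))
   + hm / PI * Cln (Csinh (z - zm) / Csinh (z + zm))
   - hp / PI * Cln (Csinh (z - zp) / Csinh (z + zp))
   - Ci * (hm - hp))%C.

(* Meant for open U. *)
Definition holomorphic_on (U : C -> Prop) (f : C -> C) : Prop :=
  forall z : C, U z -> ex_derive (K := C_AbsRing) (V := C_NormedModule) f z.

Definition biholomorphic_onto (U V : C -> Prop) (f : C -> C) : Prop :=
  (forall z : C, U z -> V (f z)) /\
  holomorphic_on U f /\
  exists g : C -> C,
    (forall w : C, V w -> U (g w)) /\
    holomorphic_on V g /\
    (forall z : C, U z -> g (f z) = z) /\
    (forall w : C, V w -> f (g w) = w).

(* Main.v *)
Require Import Defs.
From Stdlib Require Import Reals Lra Classical ClassicalEpsilon Ranalysis5.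
From Coquelicot Require Import Coquelicot.
Open Scope R_scope.

(* Write zm = i a and zp = i b; the hypotheses force a < b. In the variable
   w = exp (2 z), which maps the half strip onto the upper half disc, the
   derivative of the map is a constant times i w / (P_a P_b), where
   P_c = w^2 - 2 cos (2 c) w + 1. The function log (- P_a / P_b) maps the half
   disc onto the strip 0 < Im < pi, and in this strip coordinate p the derivative
   becomes a positive multiple of i w / (w^2 - 1), whose real part is positive.
   By the Noshiro-Warschawski argument the map q so obtained on the strip is
   injective; moreover Re q increases along horizontal lines and Im q increases
   with Im p along each level set of Re q. Every level set is therefore a
   continuous curve crossing the strip, and surjectivity follows from the
   intermediate value theorem once the limits of Im q on Re q = X at the two sides
   of the strip are known: they are -hm and u_tilde X. These limits come from a
   compactness argument on the closed half disc, where the map extends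
   continuously except at exp (2 i a) and exp (2 i b), where Re q tends to -oo and
   +oo; for X = 0 the only possible limit point is w = 0, the tip of the slit. *)

(** * Complex differentiation *)

(** The equation with the hyperbolic sines gives the two logarithms equal coefficients in front of
    [/ P_a] and [/ P_b], so the numerator of the derivative shrinks to [P_b - P_a], a multiple of
    [w]. Its zero [w = 0], where [Re z] tends to -oo, is the tip of the slit, and the equation for
    [h] fixes the height of that tip. The obstacle is the boundary: the diameter of the half disc is
    folded onto the two sides of the slit, so the boundary is not a Jordan curve and its values do
    not determine the region in the usual way. Monotonicity takes the place of boundary
    correspondence. The coordinate [p] comes from a flat channel with the same two ends: its lower
    edge is the arc between the poles, which goes to the bottom, and its upper edge is the diameter
    together with the two outer arcs. Its derivative in [w] has the same denominator [P_a P_b],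
    which therefore cancels. Positivity of the real part then says that [q] is strictly monotone as
    a plane vector field, [<r - p, q r - q p> > 0]; this one inequality yields injectivity,
    continuity of the inverse, and the order along horizontal lines and along level sets. *)

Definition cnear (z : C) (P : C -> Prop) : Prop :=
  exists d : R, 0 < d /\ forall y : C, Cmod (y - z)%C < d -> P y.

Definition ccont (f : C -> C) (z : C) : Prop :=
  forall eps : R, 0 < eps -> cnear z (fun y => Cmod (f y - f z)%C < eps).

(* Caratheodory's form of the complex derivative. *)
Definition cder (f : C -> C) (z l : C) : Prop :=
  exists phi : C -> C,
    ccont phi z /\ phi z = l /\ cnear z (fun y => (f y - f z = phi y * (y - z))%C).

Lemma cnear_and (z : C) (P Q : C -> Prop) :
  cnear z P -> cnear z Q -> cnear z (fun y => P y /\ Q y).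
Proof.
intros [d1 [h1 H1]] [d2 [h2 H2]].
exists (Rmin d1 d2); split; [now apply Rmin_glb_lt |].
intros y Hy; split; [apply H1 | apply H2]; eapply Rlt_le_trans; try exact Hy.
apply Rmin_l. apply Rmin_r.
Qed.

Lemma cnear_imp (z : C) (P Q : C -> Prop) :
  (forall y, P y -> Q y) -> cnear z P -> cnear z Q.
Proof. intros H [d [h H1]]; exists d; split; auto. Qed.

Lemma cnear_all (z : C) (P : C -> Prop) : (forall y, P y) -> cnear z P.
Proof. intros H; exists 1; split; [lra | auto]. Qed.

Lemma Cmod_minus_diag (z : C) : Cmod (z - z)%C = 0.
Proof. replace (z - z)%C with (RtoC 0) by ring. apply Cmod_0. Qed.

Lemma cnear_at (z : C) (P : C -> Prop) : cnear z P -> P z.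
Proof. intros [d [h H]]; apply H; rewrite Cmod_minus_diag; exact h. Qed.

Lemma ccont_near (f : C -> C) (z : C) (P : C -> Prop) :
  ccont f z -> cnear (f z) P -> cnear z (fun y => P (f y)).
Proof. intros Hf [d [h H]]; apply (cnear_imp z _ _ (fun y Hy => H (f y) Hy)), Hf, h. Qed.

Lemma cnear_Re_lt (w : C) (r : R) : Re w < r -> cnear w (fun y => Re y < r).
Proof.
intros H; exists (r - Re w); split; [lra |].
intros y Hy.
assert (H1 := re_le_Cmod (y - w)%C).
assert (H2 : Re (y - w)%C = Re y - Re w) by reflexivity.
rewrite H2 in H1.
assert (H3 := Rle_abs (Re y - Re w)); lra.
Qed.

Lemma im_le_Cmod (c : C) : Rabs (Im c) <= Cmod c.
Proof.
eapply Rle_trans; [| apply Rmax_Cmod]; apply Rmax_r.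
Qed.

Lemma cnear_Im_lt (w : C) (r : R) : Im w < r -> cnear w (fun y => Im y < r).
Proof.
intros H; exists (r - Im w); split; [lra |].
intros y Hy.
assert (H1 := im_le_Cmod (y - w)%C).
assert (H2 : Im (y - w)%C = Im y - Im w) by reflexivity.
rewrite H2 in H1.
assert (H3 := Rle_abs (Im y - Im w)); lra.
Qed.

Lemma cnear_Re_gt (w : C) (r : R) : r < Re w -> cnear w (fun y => r < Re y).
Proof.
intros H; exists (Re w - r); split; [lra |].
intros y Hy.
assert (H1 := re_le_Cmod (y - w)%C).
assert (H2 : Re (y - w)%C = Re y - Re w) by reflexivity.
rewrite H2 in H1.
assert (H3 := Rabs_maj2 (Re y - Re w)); lra.
Qed.

Lemma cnear_Im_gt (w : C) (r : R) : r < Im w -> cnear w (fun y => r < Im y).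
Proof.
intros H; exists (Im w - r); split; [lra |].
intros y Hy.
assert (H1 := im_le_Cmod (y - w)%C).
assert (H2 : Im (y - w)%C = Im y - Im w) by reflexivity.
rewrite H2 in H1.
assert (H3 := Rabs_maj2 (Im y - Im w)); lra.
Qed.

(** * Rules for continuity and for the derivative *)

Lemma ccont_const (c z : C) : ccont (fun _ => c) z.
Proof. intros e he; apply cnear_all; intros _; rewrite Cmod_minus_diag; exact he. Qed.

Lemma ccont_id (z : C) : ccont (fun x => x) z.
Proof. intros e he; exists e; auto. Qed.

Lemma ccont_plus (f g : C -> C) (z : C) :
  ccont f z -> ccont g z -> ccont (fun x => f x + g x)%C z.
Proof.
intros Hf Hg e he.
generalize (cnear_and _ _ _ (Hf (e / 2) ltac:(lra)) (Hg (e / 2) ltac:(lra))).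
apply cnear_imp; intros y [H1 H2].
replace (f y + g y - (f z + g z))%C with ((f y - f z) + (g y - g z))%C by ring.
eapply Rle_lt_trans; [apply Cmod_triangle | lra].
Qed.

Lemma ccont_opp (f : C -> C) (z : C) : ccont f z -> ccont (fun x => - f x)%C z.
Proof.
intros Hf e he; generalize (Hf e he); apply cnear_imp; intros y H.
replace (- f y - - f z)%C with (- (f y - f z))%C by ring.
now rewrite Cmod_opp.
Qed.

Lemma ccont_minus (f g : C -> C) (z : C) :
  ccont f z -> ccont g z -> ccont (fun x => f x - g x)%C z.
Proof. intros Hf Hg; apply ccont_plus; [exact Hf | now apply ccont_opp]. Qed.

Lemma ccont_mult (f g : C -> C) (z : C) :
  ccont f z -> ccont g z -> ccont (fun x => f x * g x)%C z.
Proof.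
intros Hf Hg e he.
assert (Pf := Cmod_ge_0 (f z)). assert (Pg := Cmod_ge_0 (g z)).
set (k := 1 + Cmod (f z) + Cmod (g z)).
assert (Hk : 0 < k) by (unfold k; lra).
assert (Hek : 0 < e / k) by (apply Rdiv_lt_0_compat; lra).
set (n := Rmin 1 (e / k)).
assert (Hn : 0 < n) by (apply Rmin_glb_lt; lra).
assert (Hn1 : n <= 1) by apply Rmin_l.
assert (Hn2 : n * k <= e).
{ apply Rle_trans with (e / k * k); [| right; field; lra].
  apply Rmult_le_compat_r; [lra | apply Rmin_r]. }
generalize (cnear_and _ _ _ (Hf n Hn) (Hg n Hn)).
apply cnear_imp; intros y [H1 H2].
replace (f y * g y - f z * g z)%C
  with ((f y - f z) * (g y - g z) + ((f y - f z) * g z + f z * (g y - g z)))%C by ring.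
eapply Rle_lt_trans; [apply Cmod_triangle |].
eapply Rle_lt_trans; [apply Rplus_le_compat_l, Cmod_triangle |].
rewrite !Cmod_mult.
assert (Q1 := Cmod_ge_0 (f y - f z)%C). assert (Q2 := Cmod_ge_0 (g y - g z)%C).
unfold k in Hn2.
assert (Cmod (f y - f z)%C * Cmod (g y - g z)%C < n * 1) by nra.
assert (Cmod (f y - f z)%C * Cmod (g z) <= n * Cmod (g z)) by nra.
assert (Cmod (f z) * Cmod (g y - g z)%C <= Cmod (f z) * n) by nra.
lra.
Qed.

Lemma cnear_neq (w c : C) : w <> c -> cnear w (fun y => y <> c).
Proof.
intros H.
exists (Cmod (c - w)%C); split.
- apply Cmod_gt_0; intros E; apply H.
  replace c with ((c - w) + w)%C by ring; rewrite E; ring.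
- intros y Hy ->; lra.
Qed.

Lemma ccont_Cinv (z : C) : z <> 0%C -> ccont Cinv z.
Proof.
intros Hz e he.
assert (Hm : 0 < Cmod z) by now apply Cmod_gt_0.
set (d := Rmin (Cmod z / 2) (e * (Cmod z * Cmod z / 2))).
assert (Hd : 0 < d).
{ apply Rmin_glb_lt; [lra |]. apply Rmult_lt_0_compat; [lra | nra]. }
exists d; split; [exact Hd |].
intros y Hy.
assert (H1 : Cmod (y - z)%C < Cmod z / 2) by (eapply Rlt_le_trans; [exact Hy | apply Rmin_l]).
assert (H2 : Cmod (y - z)%C < e * (Cmod z * Cmod z / 2))
  by (eapply Rlt_le_trans; [exact Hy | apply Rmin_r]).
assert (H3 : Cmod z / 2 < Cmod y).
{ assert (T := Cmod_triangle y (z - y)%C).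
  replace (y + (z - y))%C with z in T by ring.
  replace (z - y)%C with (- (y - z))%C in T by ring; rewrite Cmod_opp in T; lra. }
assert (Hy0 : y <> 0%C) by (apply Cmod_gt_0; lra).
replace (/ y - / z)%C with (- ((y - z) / (y * z)))%C by (field; auto).
rewrite Cmod_opp, Cmod_div, Cmod_mult by now apply Cmult_neq_0.
apply Rlt_div_l; [apply Rmult_lt_0_compat; lra |].
eapply Rlt_le_trans; [exact H2 |].
apply Rmult_le_compat_l; [lra |]. nra.
Qed.

Lemma ccont_comp (f g : C -> C) (z : C) :
  ccont g z -> ccont f (g z) -> ccont (fun x => f (g x)) z.
Proof. intros Hg Hf e he; apply (ccont_near g z (fun v => Cmod (f v - f (g z))%C < e) Hg), Hf, he. Qed.

Lemma ccont_inv (g : C -> C) (z : C) :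
  ccont g z -> g z <> 0%C -> ccont (fun x => / g x)%C z.
Proof. intros Hg H; apply (ccont_comp Cinv g); [exact Hg | now apply ccont_Cinv]. Qed.

Lemma ccont_div (f g : C -> C) (z : C) :
  ccont f z -> ccont g z -> g z <> 0%C -> ccont (fun x => f x / g x)%C z.
Proof. intros Hf Hg H; apply ccont_mult; [exact Hf | now apply ccont_inv]. Qed.

Lemma ccont_ext_loc (f g : C -> C) (z : C) :
  cnear z (fun y => f y = g y) -> ccont f z -> ccont g z.
Proof.
intros H Hf e he.
generalize (cnear_and _ _ _ H (Hf e he)); apply cnear_imp.
intros y [E Hy]; rewrite <- E, <- (cnear_at _ _ H); exact Hy.
Qed.

Lemma cder_cont (f : C -> C) (z l : C) : cder f z l -> ccont f z.
Proof.
intros [phi [Hp [_ H]]].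
apply (ccont_ext_loc (fun y => phi y * (y - z) + f z)%C).
- revert H; apply cnear_imp; intros y Hy; rewrite <- Hy; ring.
- apply ccont_plus; [| apply ccont_const].
  apply ccont_mult; [exact Hp |]. apply ccont_minus; [apply ccont_id | apply ccont_const].
Qed.

Lemma cder_ext_loc (f g : C -> C) (z l : C) :
  cnear z (fun y => f y = g y) -> cder f z l -> cder g z l.
Proof.
intros H [phi [Hp [E Hf]]]; exists phi; repeat split; auto.
generalize (cnear_and _ _ _ H Hf); apply cnear_imp.
intros y [E1 E2]; rewrite <- E1, <- (cnear_at _ _ H); exact E2.
Qed.

Lemma cder_const (c z : C) : cder (fun _ => c) z 0.
Proof.
exists (fun _ => 0%C); split; [apply ccont_const |]; split; [reflexivity |].
apply cnear_all; intros y; ring.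
Qed.

Lemma cder_id (z : C) : cder (fun x => x) z 1.
Proof.
exists (fun _ => 1%C); split; [apply ccont_const |]; split; [reflexivity |].
apply cnear_all; intros y; ring.
Qed.

Lemma cder_plus (f g : C -> C) (z l m : C) :
  cder f z l -> cder g z m -> cder (fun x => f x + g x)%C z (l + m).
Proof.
intros [p [Hp [Ep Hf]]] [q [Hq [Eq Hg]]]; exists (fun y => p y + q y)%C.
split; [now apply ccont_plus |]; split; [now rewrite Ep, Eq |].
generalize (cnear_and _ _ _ Hf Hg); apply cnear_imp; intros y [E1 E2].
transitivity ((f y - f z) + (g y - g z))%C; [ring |].
rewrite E1, E2; ring.
Qed.

Lemma cder_mult (f g : C -> C) (z l m : C) :
  cder f z l -> cder g z m -> cder (fun x => f x * g x)%C z (l * g z + f z * m).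
Proof.
intros Hf' Hg'; assert (Cg := cder_cont _ _ _ Hg').
destruct Hf' as [p [Hp [Ep Hf]]], Hg' as [q [Hq [Eq Hg]]].
exists (fun y => p y * g y + f z * q y)%C.
split.
{ apply ccont_plus; apply ccont_mult; auto; apply ccont_const. }
split; [now rewrite Ep, Eq |].
generalize (cnear_and _ _ _ Hf Hg); apply cnear_imp; intros y [E1 E2].
transitivity ((f y - f z) * g y + f z * (g y - g z))%C; [ring |].
rewrite E1, E2; ring.
Qed.

Lemma cder_scal (c : C) (f : C -> C) (z l : C) :
  cder f z l -> cder (fun x => c * f x)%C z (c * l).
Proof.
intros H; assert (H1 := cder_mult _ _ _ _ _ (cder_const c z) H); cbv beta in H1.
now replace (c * l)%C with (0 * f z + c * l)%C by ring.
Qed.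

Lemma cder_minus (f g : C -> C) (z l m : C) :
  cder f z l -> cder g z m -> cder (fun x => f x - g x)%C z (l - m).
Proof.
intros Hf Hg; assert (H := cder_plus _ _ _ _ _ Hf (cder_scal (- (1))%C _ _ _ Hg)).
cbv beta in H.
replace (l - m)%C with (l + - (1) * m)%C by ring.
revert H; apply cder_ext_loc, cnear_all; intros y; ring.
Qed.

Lemma cder_comp (f g : C -> C) (z l m : C) :
  cder g z m -> cder f (g z) l -> cder (fun x => f (g x)) z (l * m).
Proof.
intros Hg' [p [Hp [Ep Hf]]]; assert (Cg := cder_cont _ _ _ Hg').
destruct Hg' as [q [Hq [Eq Hg]]].
exists (fun y => p (g y) * q y)%C.
split; [apply ccont_mult; [now apply ccont_comp | exact Hq] |].
split; [now rewrite Ep, Eq |].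
generalize (cnear_and _ _ _ Hg (ccont_near _ _ _ Cg Hf)); apply cnear_imp.
intros y [E1 E2]; rewrite E2, E1; ring.
Qed.

Lemma cder_Cinv (z : C) : z <> 0%C -> cder Cinv z (- / (z * z)).
Proof.
intros Hz; exists (fun y => - / (y * z))%C.
split.
{ apply ccont_opp, ccont_inv; [| now apply Cmult_neq_0].
  apply ccont_mult; [apply ccont_id | apply ccont_const]. }
split; [reflexivity |].
generalize (cnear_neq z 0 Hz); apply cnear_imp; intros y Hy; field; auto.
Qed.

Lemma cder_div (f g : C -> C) (z l m : C) :
  cder f z l -> cder g z m -> g z <> 0%C ->
  cder (fun x => f x / g x)%C z ((l * g z - f z * m) / (g z * g z)).
Proof.
intros Hf Hg Hz.
assert (H := cder_mult _ _ _ _ _ Hf (cder_comp _ _ _ _ _ Hg (cder_Cinv _ Hz))).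
cbv beta in H.
replace ((l * g z - f z * m) / (g z * g z))%C
  with (l * / g z + f z * (- / (g z * g z) * m))%C; [exact H | field; auto].
Qed.

Lemma cder_eq (f : C -> C) (z l m : C) : cder f z l -> l = m -> cder f z m.
Proof. now intros H <-. Qed.

(** Substituting [g y] into the factorisation of [f] gives [y - w = phi (g y) * (g y - g w)], so
    [/ phi (g y)] is the factor for [g]. Only continuity of [g] is asked; this serves for [Cln], for
    the inverse of the strip coordinate and for the final inverse map. *)
Lemma cder_inverse (f g : C -> C) (w l : C) :
  cder f (g w) l -> l <> 0%C -> ccont g w ->
  cnear w (fun y => f (g y) = y) -> cder g w (/ l).
Proof.
intros [p [Hp [Ep Hf]]] Hl Cg Hfg.
assert (Cp : ccont (fun y => p (g y)) w) by now apply ccont_comp.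
assert (Np : p (g w) <> 0%C) by now rewrite Ep.
exists (fun y => / p (g y))%C.
split; [now apply ccont_inv |].
split; [now rewrite Ep |].
generalize (cnear_and _ _ _ Hfg
  (cnear_and _ _ _ (ccont_near _ _ _ Cg Hf) (ccont_near _ _ _ Cp (cnear_neq _ _ Np)))).
apply cnear_imp; intros y [E1 [E2 N]].
rewrite E1, (cnear_at _ _ Hfg) in E2; rewrite E2; field; exact N.
Qed.

(** The remainder is [(phi y - phi z) * (y - z)], and [phi] is continuous. Holomorphy in the final
    statement is reached through this bridge. *)
Lemma cder_ex_derive (f : C -> C) (z l : C) :
  cder f z l -> ex_derive (K := C_AbsRing) (V := C_NormedModule) f z.
Proof.
intros [p [Hp [Ep Hf]]]; exists l.
split.
{ apply (is_linear_scal_l (K := C_AbsRing) (V := C_NormedModule)). }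
intros x Hx.
assert (E : z = x) by
  (apply (is_filter_lim_locally_unique (K := C_AbsRing)
            (V := AbsRing_NormedModule C_AbsRing) z x Hx)).
subst x.
intros [e he].
destruct (cnear_and _ _ _ Hf (Hp e he)) as [d [hd Hd]].
exists (mkposreal d hd); intros y Hy.
change (Cmod (y - z)%C < d) in Hy.
destruct (Hd y Hy) as [E1 E2].
change (Cmod ((f y - f z) - (y - z) * l)%C <= e * Cmod (y - z)%C).
rewrite E1, <- Ep.
replace (p y * (y - z) - (y - z) * p z)%C with ((p y - p z) * (y - z))%C by ring.
rewrite Cmod_mult; apply Rmult_le_compat_r; [apply Cmod_ge_0 | lra].
Qed.

(** A complex function has no mean value theorem; its restriction to a line, composed with the real
    functional [Re (c * _)], has one. *)
Lemma cder_line (f : C -> C) (c p d l : C) (t : R) :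
  cder f (p + t * d) l ->
  derivable_pt_lim (fun s : R => Re (c * f (p + s * d))%C) t (Re (c * (l * d))%C).
Proof.
intros [phi [Hp [Ep Hf]]] e he.
assert (Cp : ccont (fun y => c * phi y * d)%C (p + t * d)).
{ apply ccont_mult; [apply ccont_mult; [apply ccont_const | exact Hp] | apply ccont_const]. }
destruct (cnear_and _ _ _ Hf (Cp e he)) as [r [hr Hr]].
assert (Hd : 0 < r / (1 + Cmod d)).
{ apply Rdiv_lt_0_compat; [lra | generalize (Cmod_ge_0 d); lra]. }
exists (mkposreal _ Hd); intros s Hs Hsr; simpl in Hsr.
assert (Ediff : ((p + (t + s)%R * d) - (p + t * d))%C = (s * d)%C)
  by (rewrite RtoC_plus; ring).
destruct (Hr (p + (t + s)%R * d)%C) as [E1 E2].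
{ rewrite Ediff, Cmod_mult, Cmod_R.
  apply Rlt_div_r in Hsr; [| generalize (Cmod_ge_0 d); lra].
  assert (P := Rabs_pos_lt s Hs); generalize (Cmod_ge_0 d); nra. }
rewrite Ediff in E1.
assert (E3 : Re (c * f (p + (t + s)%R * d))%C - Re (c * f (p + t * d))%C
             = s * Re (c * phi (p + (t + s)%R * d) * d)%C).
{ transitivity (Re (c * (f (p + (t + s)%R * d) - f (p + t * d)))%C).
  { simpl; ring. }
  rewrite E1; simpl; ring. }
rewrite E3.
replace (s * Re (c * phi (p + (t + s)%R * d) * d)%C / s - Re (c * (l * d))%C)
  with (Re (c * phi (p + (t + s)%R * d) * d - c * phi (p + t * d) * d)%C).
- eapply Rle_lt_trans; [apply re_le_Cmod | exact E2].
- rewrite Ep; simpl; field; exact Hs.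
Qed.

(** * The complex exponential and its derivative *)

Lemma Cexp_plus (x y : C) : Cexp (x + y) = (Cexp x * Cexp y)%C.
Proof.
destruct x as [x1 x2], y as [y1 y2]; unfold Cexp, Cmult; simpl.
rewrite exp_plus, cos_plus, sin_plus; f_equal; ring.
Qed.

Lemma Cexp_0 : Cexp 0 = 1%C.
Proof. unfold Cexp; simpl; rewrite exp_0, cos_0, sin_0, Rmult_1_l, Rmult_0_r; reflexivity. Qed.

Lemma Cmod_Cexp (z : C) : Cmod (Cexp z) = exp (Re z).
Proof.
assert (H := Cmod_sqr (Cexp z)); simpl in H.
assert (T := sin2_cos2 (Im z)); unfold Rsqr in T.
assert (P := exp_pos (Re z)); assert (P1 := Cmod_ge_0 (Cexp z)).
apply Rsqr_inj; [exact P1 | lra |]; unfold Rsqr; rewrite H.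
transitivity (exp (Re z) * exp (Re z) * (sin (Im z) * sin (Im z) + cos (Im z) * cos (Im z))); [ring | rewrite T; ring].
Qed.

Lemma Cexp_neq_0 (z : C) : Cexp z <> 0%C.
Proof. apply Cmod_gt_0; rewrite Cmod_Cexp; apply exp_pos. Qed.

Lemma Cexp_opp (z : C) : Cexp (- z) = (/ Cexp z)%C.
Proof.
assert (H : (Cexp z * Cexp (- z) = 1)%C).
{ rewrite <- Cexp_plus; replace (z + - z)%C with (RtoC 0) by ring; apply Cexp_0. }
assert (N := Cexp_neq_0 z).
replace (Cexp (- z)) with (Cexp z * Cexp (- z) / Cexp z)%C by (field; exact N).
rewrite H; field; exact N.
Qed.

Lemma Cmod_le_abs (z : C) : Cmod z <= Rabs (Re z) + Rabs (Im z).
Proof.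
assert (H := Cmod_sqr z); assert (P := Cmod_ge_0 z).
assert (A := Rabs_pos (Re z)); assert (B := Rabs_pos (Im z)).
assert (E1 : Re z * Re z = Rabs (Re z) * Rabs (Re z)) by
  (rewrite <- Rabs_mult; symmetry; apply Rabs_pos_eq; nra).
assert (E2 : Im z * Im z = Rabs (Im z) * Rabs (Im z)) by
  (rewrite <- Rabs_mult; symmetry; apply Rabs_pos_eq; nra).
rewrite E1, E2 in H; nra.
Qed.

Lemma derivable_pt_lim_le (f : R -> R) (l e : R) :
  derivable_pt_lim f 0 l -> 0 < e ->
  exists d, 0 < d /\ forall x, Rabs x < d -> Rabs (f x - f 0 - l * x) <= e * Rabs x.
Proof.
intros H he; destruct (H e he) as [[d hd] Hd]; exists d; split; [exact hd |].
intros x Hx; destruct (Req_dec x 0) as [-> | N].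
- replace (f 0 - f 0 - l * 0) with 0 by ring; rewrite Rabs_R0; lra.
- specialize (Hd x N Hx); rewrite Rplus_0_l in Hd.
  replace (f x - f 0 - l * x) with (((f x - f 0) / x - l) * x) by (field; exact N).
  rewrite Rabs_mult; apply Rmult_le_compat_r; [apply Rabs_pos | lra].
Qed.

Lemma Cexp_near_0 (e : R) :
  0 < e -> cnear 0 (fun y => Cmod (Cexp y - 1 - y)%C <= e * Cmod y).
Proof.
(* The real and the imaginary part each cost [3 * n * m], whence [e / 6]; [n <= 1] keeps
   [exp x <= 2]. *)
intros he; set (n := Rmin 1 (e / 6)).
assert (Hn : 0 < n) by (apply Rmin_glb_lt; lra).
assert (Hn1 : n <= 1) by apply Rmin_l.
assert (Hn2 : n <= e / 6) by apply Rmin_r.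
destruct (derivable_pt_lim_le exp 1 n) as [d1 [h1 H1]];
  [rewrite <- exp_0; apply derivable_pt_lim_exp | exact Hn |].
destruct (derivable_pt_lim_le cos 0 n) as [d2 [h2 H2]];
  [replace 0 with (- sin 0) at 2 by (rewrite sin_0; ring); apply derivable_pt_lim_cos | exact Hn |].
destruct (derivable_pt_lim_le sin 1 n) as [d3 [h3 H3]];
  [rewrite <- cos_0; apply derivable_pt_lim_sin | exact Hn |].
set (d := Rmin (Rmin (n / 2) d1) (Rmin d2 d3)).
exists d; split.
{ repeat apply Rmin_glb_lt; lra. }
intros [x y] Hz.
replace ((x, y) - 0)%C with ((x, y) : C) in Hz
  by (apply injective_projections; simpl; ring).
assert (Hx : Rabs x <= Cmod (x, y)) by apply (re_le_Cmod (x, y)).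
assert (Hy : Rabs y <= Cmod (x, y)) by apply (im_le_Cmod (x, y)).
set (m := Cmod (x, y)) in *.
assert (D : d <= n / 2 /\ d <= d1 /\ d <= d2 /\ d <= d3).
{ unfold d, Rmin; repeat destruct Rle_dec; lra. }
destruct D as [D0 [D1 [D2 D3]]].
specialize (H1 x ltac:(lra)); specialize (H2 y ltac:(lra)); specialize (H3 y ltac:(lra)).
rewrite exp_0 in H1; rewrite cos_0 in H2; rewrite sin_0 in H3.
assert (Px := Rabs_pos x); assert (Py := Rabs_pos y).
assert (E1 : Rabs (exp x - 1) <= n).
{ replace (exp x - 1) with ((exp x - 1 - 1 * x) + x) by ring.
  eapply Rle_trans; [apply Rabs_triang | nra]. }
assert (E0 : Rabs (exp x) <= 2).
{ replace (exp x) with ((exp x - 1) + 1) by ring.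
  eapply Rle_trans; [apply Rabs_triang | rewrite Rabs_R1; lra]. }
assert (P0 := Rabs_pos (exp x)).
eapply Rle_trans; [apply Cmod_le_abs |]; simpl.
assert (A : Rabs (exp x * cos y - 1 - x) <= n * m + 2 * (n * m)).
{ replace (exp x * cos y - 1 - x) with ((exp x - 1 - 1 * x) + exp x * (cos y - 1 - 0 * y)) by ring.
  eapply Rle_trans; [apply Rabs_triang |]; rewrite Rabs_mult.
  apply Rplus_le_compat; [nra |].
  apply Rmult_le_compat; try apply Rabs_pos; nra. }
assert (B : Rabs (exp x * sin y - 0 - y) <= 2 * (n * m) + n * m).
{ replace (exp x * sin y - 0 - y) with (exp x * (sin y - 0 - 1 * y) + (exp x - 1) * y) by ring.
  eapply Rle_trans; [apply Rabs_triang |]; rewrite !Rabs_mult.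
  apply Rplus_le_compat; apply Rmult_le_compat; try apply Rabs_pos; nra. }
replace (exp x * cos y + - (1) + - x) with (exp x * cos y - 1 - x) by ring.
replace (exp x * sin y + - 0 + - y) with (exp x * sin y - 0 - y) by ring.
assert (0 <= m) by apply Cmod_ge_0.
nra.
Qed.

Lemma cder_Cexp (z : C) : cder Cexp z (Cexp z).
Proof.
(* The difference quotient with its removable singularity filled by 1; the test is made on the real
   number [Cmod (y - z)], where equality is decidable. *)
exists (fun y => Cexp z * (if Req_EM_T (Cmod (y - z)%C) 0 then 1 else (Cexp (y - z) - 1) / (y - z)))%C.
split; [| split].
- apply ccont_mult; [apply ccont_const |].
  intros e he.
  destruct (Cexp_near_0 (e / 2) ltac:(lra)) as [d [hd Hd]].
  exists d; split; [exact hd |]; intros y Hy.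
  destruct (Req_EM_T (Cmod (z - z)%C) 0) as [_ | N]; [| now rewrite Cmod_minus_diag in N].
  destruct (Req_EM_T (Cmod (y - z)%C) 0) as [E | N].
  { rewrite Cmod_minus_diag; exact he. }
  assert (N0 : (y - z)%C <> 0%C) by (intros E; rewrite E, Cmod_0 in N; now apply N).
  specialize (Hd (y - z)%C).
  replace (y - z - 0)%C with (y - z)%C in Hd by ring.
  specialize (Hd Hy).
  replace ((Cexp (y - z) - 1) / (y - z) - 1)%C
    with ((Cexp (y - z) - 1 - (y - z)) / (y - z))%C by (field; exact N0).
  rewrite Cmod_div by exact N0.
  assert (P := proj1 (Cmod_gt_0 _) N0).
  apply Rle_lt_trans with (e / 2); [| lra].
  apply Rle_div_l; [exact P | exact Hd].
- destruct (Req_EM_T (Cmod (z - z)%C) 0) as [_ | N]; [ring | now rewrite Cmod_minus_diag in N].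
- apply cnear_all; intros y.
  destruct (Req_EM_T (Cmod (y - z)%C) 0) as [E | N].
  + apply Cmod_eq_0 in E.
    replace y with (z + (y - z))%C at 1 by ring.
    rewrite E, Cplus_0_r; ring.
  + assert (N0 : (y - z)%C <> 0%C) by (intros E; rewrite E, Cmod_0 in N; now apply N).
    replace y with (z + (y - z))%C at 1 by ring.
    rewrite Cexp_plus; field; exact N0.
Qed.

(** * The branch [Cln] of the logarithm *)

Lemma ccont_2d (f : C -> C) (x y : R) :
  continuity_2d_pt (fun u v => Re (f (u, v))) x y ->
  continuity_2d_pt (fun u v => Im (f (u, v))) x y -> ccont f (x, y).
Proof.
intros H1 H2 e he.
assert (he2 : 0 < e / 2) by lra.
destruct (H1 (mkposreal _ he2)) as [[d1 h1] D1].
destruct (H2 (mkposreal _ he2)) as [[d2 h2] D2]; simpl in *.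
exists (Rmin d1 d2); split; [now apply Rmin_glb_lt |].
intros [u v] Huv.
assert (A := re_le_Cmod ((u, v) - (x, y))%C); assert (B := im_le_Cmod ((u, v) - (x, y))%C).
assert (M1 := Rmin_l d1 d2); assert (M2 := Rmin_r d1 d2).
set (m := Cmod ((u, v) - (x, y))%C) in *.
change (Re ((u, v) - (x, y))%C) with (u - x) in A.
change (Im ((u, v) - (x, y))%C) with (v - y) in B.
specialize (D1 u v ltac:(lra) ltac:(lra)); specialize (D2 u v ltac:(lra) ltac:(lra)).
eapply Rle_lt_trans; [apply Cmod_le_abs |].
change (Re (f (u, v) - f (x, y))%C) with (Re (f (u, v)) - Re (f (x, y))).
change (Im (f (u, v) - f (x, y))%C) with (Im (f (u, v)) - Im (f (x, y))).
lra.
Qed.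

Lemma continuity_2d_Cmod (x y : R) : continuity_2d_pt (fun u v => Cmod (u, v)) x y.
Proof.
intros [e he]; exists (mkposreal (e / 2) ltac:(lra)); simpl; intros u v Hu Hv.
apply Rle_lt_trans with (Cmod ((u, v) - (x, y))%C).
- apply Rabs_le; split.
  + assert (T := Cmod_triangle (u, v) (- ((u, v) - (x, y)))%C).
    rewrite Cmod_opp in T.
    replace ((u, v) + - ((u, v) - (x, y)))%C with ((x, y) : C) in T
      by (apply injective_projections; simpl; ring).
    lra.
  + assert (T := Cmod_triangle (x, y) ((u, v) - (x, y))%C).
    replace ((x, y) + ((u, v) - (x, y)))%C with ((u, v) : C) in T
      by (apply injective_projections; simpl; ring).
    lra.
- eapply Rle_lt_trans; [apply Cmod_le_abs |].
  change (Rabs (u - x) + Rabs (v - y) < e); lra.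
Qed.

Lemma ccont_Cln (w : C) : ~ neg_imag_halfline w -> ccont Cln w.
Proof.
intros H; destruct (off_cut_pos w H) as [Hr Hs]; destruct w as [x y].
apply ccont_2d; unfold Cln; simpl.
- apply (continuity_1d_2d_pt_comp ln); [| apply continuity_2d_Cmod].
  apply derivable_continuous_pt; exists (/ Cmod (x, y)); now apply derivable_pt_lim_ln.
- unfold arg_cut; simpl.
  apply continuity_2d_pt_plus; [apply continuity_2d_pt_const |].
  apply continuity_2d_pt_mult; [apply continuity_2d_pt_const |].
  apply (continuity_1d_2d_pt_comp atan).
  { apply derivable_continuous_pt, derivable_pt_atan. }
  apply continuity_2d_pt_mult.
  { apply continuity_2d_pt_opp, continuity_2d_pt_id1. }
  apply continuity_2d_pt_inv; [| simpl in Hs; lra].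
  apply continuity_2d_pt_plus; [apply continuity_2d_Cmod | apply continuity_2d_pt_id2].
Qed.

Lemma cnear_off_cut (w : C) :
  ~ neg_imag_halfline w -> cnear w (fun y => ~ neg_imag_halfline y).
Proof.
intros H; unfold neg_imag_halfline in *.
destruct (Req_dec (Re w) 0) as [E | N].
- assert (P : 0 < Im w) by (apply Rnot_le_lt; intros P; apply H; now split).
  generalize (cnear_Im_gt _ _ P); apply cnear_imp; intros y Hy; lra.
- destruct (Rlt_or_le (Re w) 0) as [L | L].
  + generalize (cnear_Re_lt _ _ L); apply cnear_imp; intros y Hy; lra.
  + assert (L1 : 0 < Re w) by lra.
    generalize (cnear_Re_gt _ _ L1); apply cnear_imp; intros y Hy; lra.
Qed.

Lemma off_cut_neq_0 (w : C) : ~ neg_imag_halfline w -> w <> 0%C.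
Proof. intros H ->; apply H; split; simpl; lra. Qed.

Lemma cder_Cln (w : C) : ~ neg_imag_halfline w -> cder Cln w (/ w).
Proof.
intros H; apply (cder_inverse Cexp).
- rewrite <- (Cexp_Cln w H) at 2; apply cder_Cexp.
- now apply off_cut_neq_0.
- now apply ccont_Cln.
- generalize (cnear_off_cut w H); apply cnear_imp; intros y; apply Cexp_Cln.
Qed.

Lemma off_cut_Im (w : C) : 0 <= Im w -> w <> 0%C -> ~ neg_imag_halfline w.
Proof.
intros H N [E1 E2]; apply N; apply injective_projections; simpl.
- exact E1.
- change (snd w) with (Im w); lra.
Qed.

(** The window is open of length [2 * PI], so half the difference of the imaginary parts lies in
    [(- PI, PI)], where [sin] vanishes only at 0. *)
Lemma Cexp_inj_window (z w : C) :
  - (PI / 2) < Im z < 3 * (PI / 2) -> - (PI / 2) < Im w < 3 * (PI / 2) ->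
  Cexp z = Cexp w -> z = w.
Proof.
intros Hz Hw E.
assert (Er : Re z = Re w).
{ apply exp_inv; rewrite <- !Cmod_Cexp, E; reflexivity. }
assert (P := exp_pos (Re w)).
assert (Ec : cos (Im z) = cos (Im w)).
{ assert (T := f_equal fst E); simpl in T; rewrite Er in T.
  apply (Rmult_eq_reg_l (exp (Re w))); [exact T | lra]. }
assert (Es : sin (Im z) = sin (Im w)).
{ assert (T := f_equal snd E); simpl in T; rewrite Er in T.
  apply (Rmult_eq_reg_l (exp (Re w))); [exact T | lra]. }
assert (D : cos (Im z - Im w) = 1).
{ rewrite cos_minus, Ec, Es; generalize (sin2_cos2 (Im w)); unfold Rsqr; lra. }
assert (S0 : sin ((Im z - Im w) / 2) = 0).
{ replace (Im z - Im w) with (2 * ((Im z - Im w) / 2)) in D by field.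
  rewrite cos_2a_sin in D; nra. }
assert (F : (Im z - Im w) / 2 = 0).
{ destruct (Rtotal_order ((Im z - Im w) / 2) 0) as [L | [L | L]]; [| exact L |].
  - assert (0 < sin (- ((Im z - Im w) / 2))) by (apply sin_gt_0; lra).
    rewrite sin_neg in *; lra.
  - assert (0 < sin ((Im z - Im w) / 2)) by (apply sin_gt_0; lra); lra. }
apply injective_projections; [exact Er |].
change (Im z = Im w); lra.
Qed.

Lemma Cexp_window_off_cut (z : C) :
  - (PI / 2) < Im z < 3 * (PI / 2) -> ~ neg_imag_halfline (Cexp z).
Proof.
intros H [E1 E2]; simpl in E1, E2; assert (P := exp_pos (Re z)).
assert (Ec : cos (Im z) = 0) by nra.
assert (Es : sin (Im z) <= 0) by nra.
destruct (Rlt_or_le (Im z) (PI / 2)) as [L | L].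
- assert (0 < cos (Im z)) by (apply cos_gt_0; lra); lra.
- destruct (Rlt_or_le (Im z) PI) as [L1 | L1].
  + assert (0 < sin (Im z)) by (apply sin_gt_0; lra); lra.
  + assert (cos (Im z) < 0) by (apply cos_lt_0; lra); lra.
Qed.

Lemma Cln_Cexp (z : C) : - (PI / 2) < Im z < 3 * (PI / 2) -> Cln (Cexp z) = z.
Proof.
intros H; apply Cexp_inj_window; [apply arg_cut_bound | exact H |].
now apply Cexp_Cln, Cexp_window_off_cut.
Qed.

(** For [Im w > 0] the argument of [atan] in the half-angle formula lies in [(-1, 1)], because
    [|Re w| < Cmod w + Im w]. *)
Lemma arg_cut_upper (w : C) : 0 < Im w -> 0 < arg_cut w < PI.
Proof.
intros H.
assert (N : w <> 0%C) by (intros ->; simpl in H; lra).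
destruct (off_cut_pos w (off_cut_Im w (Rlt_le _ _ H) N)) as [P1 P2].
assert (S := Cmod_sqr w); assert (Hre := re_le_Cmod w).
unfold arg_cut.
assert (B : -1 < - Re w / (Cmod w + Im w) < 1).
{ assert (A1 := Rle_abs (Re w)); assert (A2 := Rabs_maj2 (Re w)); split.
  - apply Rlt_div_r; lra.
  - apply Rlt_div_l; lra. }
assert (L := atan_increasing _ _ (proj1 B)); assert (U := atan_increasing _ _ (proj2 B)).
replace (-1) with (- (1)) in L by ring.
rewrite atan_opp, atan_1 in L; rewrite atan_1 in U; lra.
Qed.

Lemma arg_cut_pos_real (r : R) : 0 < r -> arg_cut (RtoC r) = 0.
Proof.
intros H; unfold arg_cut; rewrite Cmod_R, Rabs_pos_eq by lra; simpl.
replace (- r / (r + 0)) with (- (1)) by (field; lra).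
rewrite atan_opp, atan_1; field.
Qed.

Lemma arg_cut_neg_real (r : R) : r < 0 -> arg_cut (RtoC r) = PI.
Proof.
intros H; unfold arg_cut; rewrite Cmod_R, Rabs_left by lra; simpl.
replace (- r / (- r + 0)) with 1 by (field; lra).
rewrite atan_1; field.
Qed.

(** * Maps of a strip whose derivative has positive real part *)

Definition pi_strip (p : C) : Prop := 0 < Im p < PI.

Section StripMap.

Context (q dq : C -> C)
  (Hq : forall p, pi_strip p -> cder q p (dq p))
  (Hre : forall p, pi_strip p -> 0 < Re (dq p))
  (Hdq : forall p, pi_strip p -> ccont dq p).

(** The mean value theorem for [Re (Cconj d * q)] along the segment, which stays in the convex
    strip: the derivative there is [Re (dq) * |d|^2]. *)
Lemma strip_segment (p d : C) :
  pi_strip p -> pi_strip (p + d) ->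
  exists t : R, 0 < t < 1 /\ pi_strip (p + t * d) /\
    Re (Cconj d * (q (p + d) - q p))%C = Re (dq (p + t * d)%C) * (Cmod d * Cmod d).
Proof.
intros Hp Hd.
assert (Hseg : forall t, 0 <= t <= 1 -> pi_strip (p + t * d)).
{ intros t Ht; unfold pi_strip in *.
  replace (Im (p + t * d)%C) with (Im p + t * Im d) by (unfold Re, Im; simpl; ring).
  replace (Im (p + d)%C) with (Im p + Im d) in Hd by reflexivity.
  destruct (Rle_or_lt 0 (Im d)); split; nra. }
destruct (MVT_cor2 (fun t => Re (Cconj d * q (p + t * d))%C)
            (fun t => Re (Cconj d * (dq (p + t * d) * d))%C) 0 1) as [t [E Ht]];
  [lra | intros t Ht; apply cder_line, Hq, Hseg, Ht |].
exists t; split; [exact Ht |]; split; [apply Hseg; lra |].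
rewrite Cmod_sqr.
replace (p + 1%R * d)%C with (p + d)%C in E by ring.
replace (p + 0%R * d)%C with p in E by ring.
transitivity (Re (Cconj d * q (p + d))%C - Re (Cconj d * q p)%C); [unfold Re, Im; simpl; ring |].
rewrite E; unfold Re, Im; simpl; ring.
Qed.

(** [Re (Cconj u * v)] is the inner product of plane vectors, so this is strict monotonicity of [q];
    the injectivity and order statements below specialise it. *)
Lemma strip_expand (p r : C) :
  pi_strip p -> pi_strip r -> p <> r -> 0 < Re (Cconj (r - p) * (q r - q p))%C.
Proof.
intros Hp Hr N.
assert (E : r = (p + (r - p))%C) by ring.
destruct (strip_segment p (r - p)%C) as [t [_ [Ht Et]]]; [exact Hp | now rewrite <- E |].
rewrite <- E in Et; rewrite Et.
assert (P : 0 < Cmod (r - p)%C).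
{ apply Cmod_gt_0; intros Z; apply N; rewrite E, Z; ring. }
apply Rmult_lt_0_compat; [now apply Hre | nra].
Qed.

Lemma strip_inj (p r : C) : pi_strip p -> pi_strip r -> q p = q r -> p = r.
Proof.
intros Hp Hr E.
destruct (excluded_middle_informative (p = r)) as [H | N]; [exact H |].
assert (P := strip_expand p r Hp Hr N).
rewrite E in P; simpl in P; lra.
Qed.

Lemma pi_strip_near (p : C) : pi_strip p -> cnear p pi_strip.
Proof.
intros [H1 H2]; exact (cnear_and _ _ _ (cnear_Im_gt _ _ H1) (cnear_Im_lt _ _ H2)).
Qed.

(** Let [p] be at distance at least [e]. A step [v] of length [k] from [p0] towards [p] stays where
    [Re dq > m] and gains more than [m * k^2] in the direction [v]. The rest of the way is a
    positive multiple of [v], so monotonicity gains more in the same direction. Hence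
    [|q p - q p0| * k > m * k^2]. *)
Lemma strip_inverse_continuous (p0 : C) (e : R) :
  pi_strip p0 -> 0 < e ->
  exists n, 0 < n /\
    forall p, pi_strip p -> Cmod (q p - q p0)%C < n -> Cmod (p - p0)%C < e.
Proof.
intros Hp0 he.
set (m := Re (dq p0) / 2).
assert (Hm : 0 < m) by (unfold m; generalize (Hre p0 Hp0); lra).
assert (Hm1 : m < Re (dq p0)) by (unfold m in *; lra).
destruct (cnear_and _ _ _ (pi_strip_near p0 Hp0)
  (ccont_near _ _ _ (Hdq p0 Hp0) (cnear_Re_gt _ _ Hm1))) as [d [hd Hd]].
set (k := Rmin (d / 2) (e / 2)).
assert (Hk : 0 < k) by (apply Rmin_glb_lt; lra).
assert (Hk1 : k <= d / 2) by apply Rmin_l.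
assert (Hk2 : k <= e / 2) by apply Rmin_r.
exists (m * k); split; [nra |].
intros p Hp Hlt.
apply Rnot_le_lt; intros Hge.
set (D := (p - p0)%C) in *.
set (s := k / Cmod D).
assert (Hs : 0 < s < 1).
{ unfold s; split; [apply Rdiv_lt_0_compat; lra |]. apply Rlt_div_l; lra. }
assert (HsD : s * Cmod D = k) by (unfold s; field; lra).
set (v := (s * D)%C).
assert (Hv : Cmod v = k) by (unfold v; rewrite Cmod_mult, Cmod_R, Rabs_pos_eq; lra).
assert (Hball : forall t : R, 0 <= t <= 1 -> Cmod (p0 + t * v - p0)%C < d).
{ intros t Ht; replace (p0 + t * v - p0)%C with (t * v)%C by ring.
  rewrite Cmod_mult, Cmod_R, Rabs_pos_eq, Hv by lra; nra. }
assert (Hp1 : pi_strip (p0 + v)).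
{ replace (p0 + v)%C with (p0 + 1%R * v)%C by ring; apply Hd, Hball; lra. }
destruct (strip_segment p0 v Hp0 Hp1) as [t [Ht [_ Et]]].
assert (Hdt : m < Re (dq (p0 + t * v)%C)) by (apply Hd, Hball; lra).
rewrite Hv in Et.
assert (Ep : (p - (p0 + v))%C = (((1 - s) / s)%R * v)%C).
{ unfold v; rewrite RtoC_div, RtoC_minus by lra.
  replace p with (p0 + D)%C by (unfold D; ring).
  field; intros E; apply RtoC_inj in E; lra. }
assert (Hs2 : 0 < (1 - s) / s) by (apply Rdiv_lt_0_compat; lra).
assert (X : 0 < Re (Cconj (p - (p0 + v)) * (q p - q (p0 + v)))%C).
{ apply strip_expand; try assumption.
  intros E; rewrite E in Ep.
  assert (Z := f_equal Cmod Ep).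
  rewrite Cmod_minus_diag, Cmod_mult, Cmod_R, Rabs_pos_eq, Hv in Z; [nra | lra]. }
rewrite Ep in X.
assert (X1 : 0 < Re (Cconj v * (q p - q (p0 + v)))%C).
{ replace (Re (Cconj (((1 - s) / s)%R * v) * (q p - q (p0 + v)))%C)
    with ((1 - s) / s * Re (Cconj v * (q p - q (p0 + v)))%C) in X by (unfold Re, Im; simpl; ring).
  nra. }
assert (X2 : m * (k * k) < Re (Cconj v * (q p - q p0))%C).
{ replace (Re (Cconj v * (q p - q p0))%C)
    with (Re (Cconj v * (q p - q (p0 + v)))%C + Re (Cconj v * (q (p0 + v) - q p0))%C)
    by (unfold Re, Im; simpl; ring).
  rewrite Et; nra. }
assert (X3 := Rle_trans _ _ _ (Rle_abs _) (re_le_Cmod (Cconj v * (q p - q p0))%C)).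
rewrite Cmod_mult, Cmod_conj, Hv in X3.
nra.
Qed.

Lemma strip_cont (p : C) : pi_strip p -> ccont q p.
Proof. intros Hp; exact (cder_cont _ _ _ (Hq p Hp)). Qed.

Lemma strip_Re_increasing (x1 x2 y : R) :
  0 < y < PI -> x1 < x2 -> Re (q (x1, y)) < Re (q (x2, y)).
Proof.
intros Hy Hx.
assert (P := strip_expand (x1, y) (x2, y) Hy Hy).
assert (N : ((x1, y) : C) <> (x2, y)) by (intros E; injection E; lra).
specialize (P N); simpl in P; fold (Re (q (x1, y))) (Re (q (x2, y))) in P.
assert (0 < (x2 - x1) * (Re (q (x2, y)) - Re (q (x1, y)))) by (unfold Re in *; nra).
nra.
Qed.

Lemma strip_level_increasing (p r : C) :
  pi_strip p -> pi_strip r -> Re (q p) = Re (q r) -> Im p < Im r -> Im (q p) < Im (q r).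
Proof.
intros Hp Hr E L.
assert (N : p <> r) by (intros Z; rewrite Z in L; lra).
assert (P := strip_expand p r Hp Hr N).
replace (Re (Cconj (r - p) * (q r - q p))%C)
  with ((Re r - Re p) * (Re (q r) - Re (q p)) + (Im r - Im p) * (Im (q r) - Im (q p)))
  in P by (unfold Re, Im; simpl; ring).
rewrite E in P; nra.
Qed.

Context (Hwide : forall X y, 0 < y < PI ->
  (exists x, Re (q (x, y)) < X) /\ (exists x, X < Re (q (x, y)))).

Lemma strip_row_continuous (y : R) : 0 < y < PI -> continuity (fun x => Re (q (x, y))).
Proof.
intros Hy x e he.
destruct (strip_cont (x, y) Hy e he) as [d [hd Hd]].
exists d; split; [exact hd |]; intros x' [_ Hx'].
simpl in *; unfold R_dist in *.
eapply Rle_lt_trans; [| apply (Hd (x', y))].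
- apply (re_le_Cmod (q (x', y) - q (x, y))%C).
- eapply Rle_lt_trans; [apply Cmod_le_abs |].
  change (Rabs (x' - x) + Rabs (y - y) < d).
  replace (y - y) with 0 by ring; rewrite Rabs_R0; lra.
Qed.

Lemma strip_level_exists (X y : R) : 0 < y < PI -> exists x, Re (q (x, y)) = X.
Proof.
intros Hy; destruct (Hwide X y Hy) as [[x1 H1] [x2 H2]].
assert (L : x1 < x2).
{ apply Rnot_le_lt; intros [L | E].
  - generalize (strip_Re_increasing x2 x1 y Hy L); lra.
  - rewrite E in H2; lra. }
destruct (IVT (fun x => Re (q (x, y)) - X) x1 x2) as [x [_ Hx]]; [| exact L | lra | lra |].
- apply continuity_minus; [now apply strip_row_continuous |].
  apply continuity_const; intros ? ?; reflexivity.
- exists x; lra.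
Qed.

(** At height [y] the points [xi y - d / 2] and [xi y + d / 2] have real parts strictly below and
    above [X]. This persists at nearby heights [t], and monotonicity along rows then traps [xi t]
    between them. *)
Lemma strip_level_curve (X : R) :
  exists xi : R -> R,
    (forall y, 0 < y < PI -> Re (q (xi y, y)) = X) /\
    (forall y, 0 < y < PI -> continuity_pt (fun t => Im (q (xi t, t))) y).
Proof.
assert (H : forall y, exists x, 0 < y < PI -> Re (q (x, y)) = X).
{ intros y; destruct (excluded_middle_informative (0 < y < PI)) as [Hy | N].
  - destruct (strip_level_exists X y Hy) as [x Hx]; now exists x.
  - exists 0; intros Hy; now destruct N. }
set (xi := fun y => proj1_sig (constructive_indefinite_description _ (H y))).
assert (Hxi : forall y, 0 < y < PI -> Re (q (xi y, y)) = X).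
{ intros y Hy; unfold xi; destruct constructive_indefinite_description as [x Hx]; now apply Hx. }
exists xi; split; [exact Hxi |].
intros y Hy e he.
destruct (strip_cont (xi y, y) Hy e he) as [d [hd Hd]].
assert (Lo := strip_Re_increasing (xi y - d / 2) (xi y) y Hy ltac:(lra)).
assert (Hi := strip_Re_increasing (xi y) (xi y + d / 2) y Hy ltac:(lra)).
rewrite (Hxi y Hy) in Lo, Hi.
destruct (ccont_near q (xi y - d / 2, y) _ (strip_cont (xi y - d / 2, y) Hy) (cnear_Re_lt _ _ Lo)) as [d1 [h1 H1]].
destruct (ccont_near q (xi y + d / 2, y) _ (strip_cont (xi y + d / 2, y) Hy) (cnear_Re_gt _ _ Hi)) as [d2 [h2 H2]].
assert (Hv : forall x t : R, Cmod ((x, t) - (x, y))%C <= Rabs (t - y)).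
{ intros x t; eapply Rle_trans; [apply Cmod_le_abs |].
  change (Rabs (x - x) + Rabs (t - y) <= Rabs (t - y)).
  replace (x - x) with 0 by ring; rewrite Rabs_R0; lra. }
set (r := Rmin (Rmin d1 d2) (Rmin (d / 2) (Rmin y (PI - y)))).
assert (Hr : 0 < r) by (repeat apply Rmin_glb_lt; lra).
assert (R : r <= d1 /\ r <= d2 /\ r <= d / 2 /\ r <= y /\ r <= PI - y).
{ unfold r, Rmin; repeat destruct Rle_dec; lra. }
exists r; split; [exact Hr |]; intros t [_ Ht]; simpl in *; unfold R_dist in *.
assert (Hty := Rabs_def2 _ _ Ht).
assert (Ht0 : 0 < t < PI) by lra.
specialize (H1 (xi y - d / 2, t)); specialize (H2 (xi y + d / 2, t)).
assert (V1 := Hv (xi y - d / 2) t); assert (V2 := Hv (xi y + d / 2) t).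
specialize (H1 ltac:(lra)); specialize (H2 ltac:(lra)); cbv beta in H1, H2.
assert (B1 : xi y - d / 2 < xi t).
{ apply Rnot_le_lt; intros [L | E].
  - generalize (strip_Re_increasing _ _ t Ht0 L); rewrite (Hxi t Ht0); lra.
  - rewrite <- E, (Hxi t Ht0) in H1; lra. }
assert (B2 : xi t < xi y + d / 2).
{ apply Rnot_le_lt; intros [L | E].
  - generalize (strip_Re_increasing _ _ t Ht0 L); rewrite (Hxi t Ht0); lra.
  - rewrite E, (Hxi t Ht0) in H2; lra. }
eapply Rle_lt_trans; [apply (im_le_Cmod (q (xi t, t) - q (xi y, y))%C) |].
apply Hd; eapply Rle_lt_trans; [apply Cmod_le_abs |].
change (Rabs (xi t - xi y) + Rabs (t - y) < d).
assert (Rabs (xi t - xi y) < d / 2) by (apply Rabs_def1; lra).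
lra.
Qed.

(** Limits are required one level set at a time, so [top] may jump, as [u_tilde] does at 0. At the
    lower edge an upper estimate is enough, since [Hbot] bounds from below. *)
Context (bot : R) (top : R -> R)
  (Hbot : forall p, pi_strip p -> bot < Im (q p))
  (Hlim : forall X e, 0 < e -> exists d, 0 < d /\
     forall p, pi_strip p -> Re (q p) = X ->
       (PI - d < Im p -> Rabs (Im (q p) - top X) < e) /\ (Im p < d -> Im (q p) < bot + e)).

(** If the value had reached [top X] at [p], it would exceed it by a definite gap a little higher on
    the level curve and keep growing, against the limit [top X] at the upper edge. *)
Lemma strip_into (p : C) : pi_strip p -> Im (q p) < top (Re (q p)).
Proof.
intros Hp; apply Rnot_le_lt; intros Hge.
set (X := Re (q p)) in *.
destruct (strip_level_curve X) as [xi [Hxi _]].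
unfold pi_strip in Hp.
(* A first move upwards makes the excess over [top X] strictly positive, so that it can serve as [e]
   in [Hlim]. *)
set (y1 := (Im p + PI) / 2).
assert (Hy1 : 0 < y1 < PI) by (unfold y1; lra).
assert (L1 : Im (q p) < Im (q (xi y1, y1))).
{ apply strip_level_increasing; [exact Hp | exact Hy1 | now rewrite Hxi |].
  simpl; unfold y1; lra. }
destruct (Hlim X (Im (q (xi y1, y1)) - top X)) as [d [hd Hd]]; [lra |].
set (y2 := Rmax ((y1 + PI) / 2) (PI - d / 2)).
assert (Hy2 : y1 < y2 /\ y2 < PI /\ PI - d < y2).
{ unfold y2, Rmax; destruct Rle_dec; lra. }
assert (S2 : 0 < y2 < PI) by lra.
assert (L2 : Im (q (xi y1, y1)) < Im (q (xi y2, y2))).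
{ apply strip_level_increasing; [exact Hy1 | exact S2 | now rewrite !Hxi | simpl; lra]. }
destruct (Hd (xi y2, y2) S2 (Hxi y2 S2)) as [A _].
specialize (A ltac:(simpl; lra)); apply Rabs_def2 in A; lra.
Qed.

Lemma strip_onto (w : C) :
  bot < Im w < top (Re w) -> exists p, pi_strip p /\ q p = w.
Proof.
intros [Hb Ht].
destruct (strip_level_curve (Re w)) as [xi [Hxi Cxi]].
set (e := Rmin (Im w - bot) (top (Re w) - Im w)).
assert (He : 0 < e) by (apply Rmin_glb_lt; lra).
assert (He1 : e <= Im w - bot) by apply Rmin_l.
assert (He2 : e <= top (Re w) - Im w) by apply Rmin_r.
destruct (Hlim (Re w) e He) as [d [hd Hd]].
assert (P := PI_RGT_0).
set (y1 := Rmin (d / 2) (PI / 3)); set (y2 := Rmax (PI - d / 2) (2 * PI / 3)).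
assert (Hy : 0 < y1 < PI /\ 0 < y2 < PI /\ y1 < y2 /\ y1 < d /\ PI - d < y2).
{ unfold y1, y2, Rmin, Rmax; repeat destruct Rle_dec; lra. }
destruct Hy as [Hy1 [Hy2 [H12 [Hd1 Hd2]]]].
assert (A1 := proj2 (Hd (xi y1, y1) Hy1 (Hxi y1 Hy1)) Hd1).
assert (A2 := proj1 (Hd (xi y2, y2) Hy2 (Hxi y2 Hy2)) Hd2).
apply Rabs_def2 in A2.
destruct (IVT_interv (fun t => Im (q (xi t, t)) - Im w) y1 y2) as [y [Y1 Y2]].
- intros t Ht1.
  apply continuity_pt_minus; [apply Cxi; lra |].
  apply continuity_pt_const; intros ? ?; reflexivity.
- exact H12.
- lra.
- lra.
- assert (Hy : 0 < y < PI) by lra.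
  exists (xi y, y); split; [exact Hy |].
  apply injective_projections; [exact (Hxi y Hy) |].
  change (Im (q (xi y, y)) = Im w); lra.
Qed.

End StripMap.

(** * The dam map in half-disc and strip coordinates *)

Definition half_disc (w : C) : Prop := Re w * Re w + Im w * Im w < 1 /\ 0 < Im w.

Definition closed_half_disc (w : C) : Prop := Re w * Re w + Im w * Im w <= 1 /\ 0 <= Im w.

Lemma half_disc_closed (w : C) : half_disc w -> closed_half_disc w.
Proof. intros [H1 H2]; split; lra. Qed.

(* With [(c, s) = exp (2 z0)] and [w = exp (2 z)], this is [sinh (z - z0) / sinh (z + z0)]. *)
Definition disc_ratio (c s : R) (w : C) : C := (((c, - s)%R * w - 1) / (w - (c, - s)%R))%C.

Definition quad (c : R) (w : C) : C := (w * w - 2 * c * w + 1)%C.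

(** * One logarithmic term in the disc variable *)

Section Ratio.

Context (c s : R) (Hcs : c * c + s * s = 1) (Hs : 0 < s).

Lemma quad_factor (w : C) : quad c w = ((w - (c, s)%R) * (w - (c, - s)%R))%C.
Proof. apply injective_projections; simpl; nra. Qed.

Lemma pole_conj : ((c, - s)%R * (c, s)%R = 1)%C.
Proof. apply injective_projections; simpl; nra. Qed.

Lemma pole_neq_0 : ((c, - s) : C) <> 0%C.
Proof. intros E; injection E; lra. Qed.

Lemma sub_pole_neq_0 (w : C) : 0 <= Im w -> (w - (c, - s)%R)%C <> 0%C.
Proof.
intros H E; assert (T := f_equal Im E); unfold Im in *; simpl in T; lra.
Qed.

Lemma Csub_neq_0 (x y : C) : x <> y -> (x - y)%C <> 0%C.
Proof. intros N E; apply N; replace x with (x - y + y)%C by ring; rewrite E; ring. Qed.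

Lemma quad_neq_0 (w : C) : closed_half_disc w -> w <> (c, s) -> quad c w <> 0%C.
Proof.
intros [_ H] N; rewrite quad_factor; apply Cmult_neq_0.
- now apply Csub_neq_0.
- now apply sub_pole_neq_0.
Qed.

Lemma ratio_den_pos (w : C) : 0 <= Im w ->
  0 < (Re w - c) * (Re w - c) + (Im w + s) * (Im w + s).
Proof.
intros H.
assert (0 < (Im w + s) * (Im w + s)) by (apply Rmult_lt_0_compat; lra).
assert (0 <= (Re w - c) * (Re w - c)) by apply Rle_0_sqr.
lra.
Qed.

Lemma Re_disc_ratio (w : C) : 0 <= Im w ->
  Re (disc_ratio c s w) = ((1 + (Re w * Re w + Im w * Im w)) * c - 2 * Re w)
    / ((Re w - c) * (Re w - c) + (Im w + s) * (Im w + s)).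
Proof.
intros H; assert (P := ratio_den_pos w H); destruct w as [p q]; unfold Re, Im in *; simpl in *.
apply (Rmult_eq_reg_r ((p - c) * (p - c) + (q + s) * (q + s))); [| lra].
(* The identity holds only modulo [Hcs], which [field] cannot use; the intermediate form isolates
   [c * c + s * s] for rewriting. *)
transitivity ((c * c + s * s) * - p + c * (p * p + q * q) + c - p).
- field; intros E; nra.
- rewrite Hcs; field; lra.
Qed.

(** The sign is that of [1 - |w|^2]: the half disc goes to the upper half plane and the unit arc to
    the real axis, so on the closed half disc the cut is met only at the zero [(c, s)]. *)
Lemma Im_disc_ratio (w : C) : 0 <= Im w ->
  Im (disc_ratio c s w) = (1 - (Re w * Re w + Im w * Im w)) * s
    / ((Re w - c) * (Re w - c) + (Im w + s) * (Im w + s)).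
Proof.
intros H; assert (P := ratio_den_pos w H); destruct w as [p q]; unfold Re, Im in *; simpl in *.
apply (Rmult_eq_reg_r ((p - c) * (p - c) + (q + s) * (q + s))); [| lra].
transitivity (- (c * c + s * s) * q - s * (p * p + q * q) + s + q + 0).
- field; intros E; nra.
- rewrite Hcs; field; lra.
Qed.

Lemma disc_ratio_off_cut (w : C) :
  closed_half_disc w -> w <> (c, s) -> ~ neg_imag_halfline (disc_ratio c s w).
Proof.
intros [H1 H2] N.
assert (P := ratio_den_pos w H2).
apply off_cut_Im.
- rewrite Im_disc_ratio by exact H2.
  apply Rdiv_le_0_compat; [nra | exact P].
- unfold disc_ratio.
  replace ((c, - s)%R * w - 1)%C with ((c, - s)%R * (w - (c, s)%R))%C
    by (rewrite <- pole_conj; ring).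
  apply Cmult_neq_0.
  + apply Cmult_neq_0; [apply pole_neq_0 | now apply Csub_neq_0].
  + intros E.
    assert (T := Cinv_r (w - (c, - s)%R)%C (sub_pole_neq_0 w H2)).
    rewrite E, Cmult_0_r in T; injection T; lra.
Qed.

(** The ratio is a Moebius map with zero [(c, s)] and pole [(c, - s)], so its logarithmic derivative
    is the difference of the two simple fractions. Writing [(c, s)] as the inverse of [(c, - s)]
    leaves an identity in one unknown unit. *)
Lemma cder_ln_disc_ratio (w : C) :
  closed_half_disc w -> w <> (c, s) ->
  cder (fun x => Cln (disc_ratio c s x)) w (2 * Ci * s / quad c w)%C.
Proof.
intros Hw N.
assert (Hoff := disc_ratio_off_cut w Hw N).
assert (N1 := sub_pole_neq_0 w (proj2 Hw)).
assert (N2 := Csub_neq_0 _ _ N).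
assert (N0 := pole_neq_0).
assert (Ee := pole_conj).
assert (Ei : (2 * Ci * s)%C = ((c, s)%R - (c, - s)%R)%C)
  by (apply injective_projections; simpl; ring).
rewrite Ei, quad_factor.
assert (Ec : ((c, s) : C) = (/ (c, - s)%R)%C).
{ replace ((c, s) : C) with ((c, - s)%R * (c, s)%R / (c, - s)%R)%C by (field; exact N0).
  rewrite Ee; field; exact N0. }
eapply cder_eq.
{ apply (cder_comp Cln (disc_ratio c s)).
  - apply cder_div; [| | exact N1].
    + apply cder_minus; [| apply cder_const].
      apply cder_scal, cder_id.
    + apply cder_minus; [apply cder_id | apply cder_const].
  - now apply cder_Cln. }
cbv beta; rewrite Ec in *; unfold disc_ratio.
set (e := ((c, - s) : C)) in *.
assert (N3 : (e * w - 1)%C <> 0%C).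
{ replace (e * w - 1)%C with (e * (w - / e))%C by (field; exact N0).
  now apply Cmult_neq_0. }
field; repeat split; auto; now rewrite Cmult_comm.
Qed.

(** This is why the diameter is sent to the imaginary axis, which carries the slit. *)
Lemma Cmod_disc_ratio_real (p : R) : Cmod (disc_ratio c s (p, 0)) = 1.
Proof.
assert (N := sub_pole_neq_0 (p, 0) (Rle_refl 0)).
unfold disc_ratio; rewrite Cmod_div by exact N.
assert (P := proj1 (Cmod_gt_0 _) N).
assert (E : Cmod ((c, - s)%R * (p, 0)%R - 1)%C = Cmod ((p, 0)%R - (c, - s)%R)%C).
{ apply Rsqr_inj; try apply Cmod_ge_0; unfold Rsqr; rewrite !Cmod_sqr; simpl; nra. }
rewrite E; field; lra.
Qed.

Lemma disc_ratio_circle (p q : R) : 0 <= q -> p * p + q * q = 1 ->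
  disc_ratio c s (p, q) = RtoC (2 * (c - p) / ((p - c) * (p - c) + (q + s) * (q + s))).
Proof.
intros Hq H; apply injective_projections.
- change (Re (disc_ratio c s (p, q)) = 2 * (c - p) / ((p - c) * (p - c) + (q + s) * (q + s))).
  rewrite Re_disc_ratio by exact Hq; simpl; rewrite H; f_equal; ring.
- change (Im (disc_ratio c s (p, q)) = 0).
  rewrite Im_disc_ratio by exact Hq; simpl; rewrite H; unfold Rdiv; ring.
Qed.

(** On the arc the ratio is real and changes sign at [(c, s)]. The jumps of the two arguments
    produce the three constant heights of the horizontal boundary. *)
Lemma arg_disc_ratio_circle (p q : R) : 0 <= q -> p * p + q * q = 1 ->
  (p < c -> arg_cut (disc_ratio c s (p, q)) = 0) /\
  (c < p -> arg_cut (disc_ratio c s (p, q)) = PI).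
Proof.
intros Hq H; rewrite disc_ratio_circle by assumption.
assert (P := ratio_den_pos (p, q) Hq); simpl in P.
split; intros L.
- apply arg_cut_pos_real, Rdiv_lt_0_compat; lra.
- apply arg_cut_neg_real.
  unfold Rdiv; assert (0 < / ((p - c) * (p - c) + (q + s) * (q + s))) by now apply Rinv_0_lt_compat.
  nra.
Qed.

Lemma arg_disc_ratio_upper (w : C) : half_disc w -> 0 < arg_cut (disc_ratio c s w) < PI.
Proof.
intros [H1 H2]; apply arg_cut_upper; rewrite Im_disc_ratio by lra.
apply Rdiv_lt_0_compat; [apply Rmult_lt_0_compat; lra | apply ratio_den_pos; lra].
Qed.

Lemma ccont_disc_ratio (w : C) : 0 <= Im w -> ccont (disc_ratio c s) w.
Proof.
intros H; unfold disc_ratio; apply ccont_div; [| | now apply sub_pole_neq_0].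
- apply ccont_minus; [| apply ccont_const].
  apply ccont_mult; [apply ccont_const | apply ccont_id].
- apply ccont_minus; [apply ccont_id | apply ccont_const].
Qed.

Lemma disc_ratio_zero : disc_ratio c s (c, s) = 0%C.
Proof.
unfold disc_ratio; rewrite pole_conj.
replace (1 - 1)%C with (RtoC 0) by ring; unfold Cdiv; ring.
Qed.

Lemma ln_disc_ratio_to_minus_infty (T : R) :
  cnear (c, s) (fun w => half_disc w -> ln (Cmod (disc_ratio c s w)) < T).
Proof.
assert (Cr : ccont (disc_ratio c s) (c, s)) by (apply ccont_disc_ratio; simpl; lra).
generalize (Cr (exp T) (exp_pos T)); apply cnear_imp; intros w Hw Hd.
rewrite disc_ratio_zero in Hw.
replace (disc_ratio c s w - 0)%C with (disc_ratio c s w) in Hw by ring.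
rewrite <- (ln_exp T); apply ln_increasing; [| exact Hw].
apply Cmod_gt_0, off_cut_neq_0, disc_ratio_off_cut; [now apply half_disc_closed |].
intros ->; destruct Hd as [Hd _]; simpl in Hd; lra.
Qed.

Lemma ln_disc_ratio_near (z : C) : closed_half_disc z -> z <> (c, s) ->
  cnear z (fun w => Rabs (ln (Cmod (disc_ratio c s w)) - ln (Cmod (disc_ratio c s z))) < 1).
Proof.
intros Hz N.
generalize (cder_cont _ _ _ (cder_ln_disc_ratio z Hz N) 1 Rlt_0_1); apply cnear_imp.
intros w Hw; eapply Rle_lt_trans; [| exact Hw].
apply (re_le_Cmod (Cln (disc_ratio c s w) - Cln (disc_ratio c s z))%C).
Qed.

(** On the circle [w + / w = 2 * Re w], and [quad k w = w * (w + / w - 2 * k)]. *)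
Lemma quad_circle (k p q : R) : p * p + q * q = 1 -> quad k (p, q) = (2 * (p - k) * (p, q)%R)%C.
Proof. intros H; apply injective_projections; simpl; nra. Qed.

End Ratio.

Lemma half_disc_neq_unit (c s : R) (w : C) :
  c * c + s * s = 1 -> half_disc w -> w <> (c, s).
Proof. intros H [H1 _] ->; simpl in H1; lra. Qed.

Lemma RtoC_neq_0 (r : R) : r <> 0 -> RtoC r <> 0%C.
Proof. intros H E; apply H; now injection E. Qed.

Lemma Re_div (x y : C) :
  y <> 0%C -> Re (x / y)%C = (Re x * Re y + Im x * Im y) / (Re y * Re y + Im y * Im y).
Proof.
intros N; assert (P := proj1 (Cmod_gt_0 y) N); assert (Q := Cmod_sqr y).
unfold Re, Im in *; simpl; field; intros E; nra.
Qed.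

Lemma Im_div (x y : C) :
  y <> 0%C -> Im (x / y)%C = (Im x * Re y - Re x * Im y) / (Re y * Re y + Im y * Im y).
Proof.
intros N; assert (P := proj1 (Cmod_gt_0 y) N); assert (Q := Cmod_sqr y).
unfold Re, Im in *; simpl; field; intros E; nra.
Qed.

Lemma norm2_pos (y : C) : y <> 0%C -> 0 < Re y * Re y + Im y * Im y.
Proof. intros N; rewrite <- Cmod_sqr; assert (P := proj1 (Cmod_gt_0 y) N); nra. Qed.

(* The root [w] of [w + / w = 2 (1 - zeta) / (1 + zeta)] in the upper half disc. *)
Definition joukowski_root (zeta : C) : C :=
  let s := Cexp ((/ 2)%R * Cln zeta) in ((1 + Ci * s) / (1 - Ci * s))%C.

(** * The dam map and the strip coordinate on the half disc *)

Section HalfDiscMap.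

Context (hm hp ca sa cb sb : R)
  (Ha : ca * ca + sa * sa = 1) (Hb : cb * cb + sb * sb = 1)
  (Hsa : 0 < sa) (Hsb : 0 < sb) (Hcab : cb < ca)
  (Hhm : 0 < hm) (Hhp : 0 < hp) (Heq : hm * sa = hp * sb).

(* [Q_tilde] in the variable [w = exp (2 z)]. *)
Definition disc_map (w : C) : C :=
  (hm / PI * Cln (disc_ratio ca sa w) - hp / PI * Cln (disc_ratio cb sb w)
   - Ci * (hm - hp))%C.

Definition disc_map_der (w : C) : C :=
  ((4 * (hm * sa * (ca - cb) / PI))%R * Ci * (w / (quad ca w * quad cb w)))%C.

(** [Heq] equates the coefficients of [/ quad ca w] and [/ quad cb w]; the quadratic and constant
    terms of [quad cb w - quad ca w] cancel and leave [2 * (ca - cb) * w]. *)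
Lemma cder_disc_map (w : C) :
  closed_half_disc w -> w <> (ca, sa) -> w <> (cb, sb) ->
  cder disc_map w (disc_map_der w).
Proof.
intros Hw Na Nb.
assert (Pa := quad_neq_0 ca sa Ha Hsa w Hw Na).
assert (Pb := quad_neq_0 cb sb Hb Hsb w Hw Nb).
assert (P := PI_RGT_0).
eapply cder_eq.
{ apply cder_minus; [| apply cder_const].
  apply cder_minus; apply cder_scal.
  - now apply cder_ln_disc_ratio.
  - now apply cder_ln_disc_ratio. }
unfold disc_map_der.
assert (NP : RtoC PI <> 0%C) by (apply RtoC_neq_0; lra).
assert (E : (RtoC hp * RtoC sb)%C = (RtoC hm * RtoC sa)%C) by (rewrite <- !RtoC_mult; now rewrite Heq).
rewrite RtoC_mult, RtoC_div, !RtoC_mult, RtoC_minus by lra.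
transitivity (RtoC hm * RtoC sa * (2 * Ci) / PI * (/ quad ca w - / quad cb w))%C.
{ transitivity (RtoC hm * RtoC sa * (2 * Ci) / PI * / quad ca w
     - RtoC hp * RtoC sb * (2 * Ci) / PI * / quad cb w)%C; [field; auto |].
  rewrite E; ring. }
replace (/ quad ca w - / quad cb w)%C
  with ((quad cb w - quad ca w) / (quad ca w * quad cb w))%C by (field; auto).
replace (quad cb w - quad ca w)%C with (2 * (ca - cb) * w)%C by (unfold quad; ring).
field; auto.
Qed.

(* A Moebius function of [w + / w]: it maps the half disc onto the upper half
   plane and sends the poles [(ca, sa)] and [(cb, sb)] to [0] and infinity. *)
Definition disc_quot (w : C) : C := (- quad ca w / quad cb w)%C.

Lemma Im_disc_quot (w : C) : quad cb w <> 0%C ->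
  Im (disc_quot w) = 2 * Im w * (1 - (Re w * Re w + Im w * Im w)) * (ca - cb)
    / (Re (quad cb w) * Re (quad cb w) + Im (quad cb w) * Im (quad cb w)).
Proof.
intros N; unfold disc_quot; rewrite Im_div by exact N.
f_equal; unfold quad, Re, Im; simpl; ring.
Qed.

Lemma disc_quot_off_cut (w : C) :
  closed_half_disc w -> w <> (ca, sa) -> w <> (cb, sb) ->
  0 <= Im (disc_quot w) /\ disc_quot w <> 0%C.
Proof.
intros Hw Na Nb.
assert (Pa := quad_neq_0 ca sa Ha Hsa w Hw Na).
assert (Pb := quad_neq_0 cb sb Hb Hsb w Hw Nb).
split.
- rewrite Im_disc_quot by exact Pb.
  apply Rdiv_le_0_compat; [| now apply norm2_pos].
  destruct Hw as [H1 H2].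
  apply Rmult_le_pos; [apply Rmult_le_pos; lra | lra].
- intros E; apply Pa.
  unfold disc_quot in E.
  replace (quad ca w) with (- (- quad ca w / quad cb w * quad cb w))%C by (field; exact Pb).
  rewrite E; ring.
Qed.

Lemma disc_quot_upper (w : C) : half_disc w -> 0 < Im (disc_quot w).
Proof.
intros Hw.
assert (Pb := quad_neq_0 cb sb Hb Hsb w (half_disc_closed w Hw)
  (half_disc_neq_unit cb sb w Hb Hw)).
rewrite Im_disc_quot by exact Pb.
destruct Hw as [H1 H2].
apply Rdiv_lt_0_compat; [| now apply norm2_pos].
apply Rmult_lt_0_compat; [apply Rmult_lt_0_compat; lra | lra].
Qed.

(** The denominator is that of [disc_map_der], so it cancels when [disc_map] is differentiated in
    the strip coordinate. *)
Lemma cder_ln_disc_quot (w : C) :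
  closed_half_disc w -> w <> (ca, sa) -> w <> (cb, sb) ->
  cder (fun x => Cln (disc_quot x)) w
    (2 * (ca - cb) * (w * w - 1) / (quad ca w * quad cb w))%C.
Proof.
intros Hw Na Nb.
assert (Pa := quad_neq_0 ca sa Ha Hsa w Hw Na).
assert (Pb := quad_neq_0 cb sb Hb Hsb w Hw Nb).
destruct (disc_quot_off_cut w Hw Na Nb) as [Q1 Q2].
assert (Hquad : forall c, cder (quad c) w (2 * (w - c))%C).
{ intros c; unfold quad; eapply cder_eq.
  - apply cder_plus; [| apply cder_const].
    apply cder_minus; [apply cder_mult; apply cder_id |].
    apply cder_scal, cder_id.
  - cbv beta; ring. }
eapply cder_eq.
{ apply (cder_comp Cln disc_quot).
  - unfold disc_quot; apply cder_div; [| apply Hquad | exact Pb].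
    apply (cder_ext_loc (fun x => (- (1)) * quad ca x)%C);
      [apply cnear_all; intros y; ring |].
    apply cder_scal, Hquad.
  - now apply cder_Cln, off_cut_Im. }
unfold disc_quot.
transitivity ((2 * (w - ca) * quad cb w - 2 * (w - cb) * quad ca w)
  / (quad ca w * quad cb w))%C; [field; auto |].
f_equal; unfold quad; ring.
Qed.

(** Equality of the quotients amounts to [(w - v) * (w * v - 1) = 0], by dependence on [w + / w]
    alone; the second factor cannot vanish since [|w * v| < 1]. *)
Lemma disc_quot_inj (w v : C) :
  half_disc w -> half_disc v -> disc_quot w = disc_quot v -> w = v.
Proof.
intros Hw Hv E.
assert (Pw := quad_neq_0 cb sb Hb Hsb w (half_disc_closed w Hw)
  (half_disc_neq_unit cb sb w Hb Hw)).
assert (Pv := quad_neq_0 cb sb Hb Hsb v (half_disc_closed v Hv)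
  (half_disc_neq_unit cb sb v Hb Hv)).
destruct (excluded_middle_informative (w = v)) as [H | N]; [exact H | exfalso].
assert (E1 : (2 * (ca - cb) * ((w - v) * (w * v - 1)) = 0)%C).
{ transitivity ((disc_quot v - disc_quot w) * (quad cb w * quad cb v))%C.
  - unfold disc_quot; transitivity (quad ca w * quad cb v - quad ca v * quad cb w)%C.
    + unfold quad; ring.
    + field; auto.
  - rewrite E; ring. }
revert E1; apply Cmult_neq_0.
- apply Cmult_neq_0; [apply RtoC_neq_0; lra |].
  rewrite <- RtoC_minus; apply RtoC_neq_0; lra.
- apply Cmult_neq_0; [now apply Csub_neq_0 |].
  apply Csub_neq_0; intros E2.
  assert (T := f_equal Cmod E2); rewrite Cmod_mult, Cmod_1 in T.
  assert (Lw := Cmod_sqr w); assert (Lv := Cmod_sqr v).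
  assert (Gw := Cmod_ge_0 w); assert (Gv := Cmod_ge_0 v).
  destruct Hw as [Hw _], Hv as [Hv _].
  assert (Cmod w < 1) by nra. assert (Cmod v < 1) by nra.
  nra.
Qed.

(** * The inverse of the strip coordinate *)

(** With [J = w + / w], the equation [- P_a / P_b = Cexp p] is linear in [J]; this is its solution
    expressed through [zeta = (2 - J) / (2 + J)], the variable in which [J] is solved for [w] by a
    square root. *)
Definition strip_zeta (p : C) : C :=
  (((1 - ca) + (1 - cb) * Cexp p) / ((1 + ca) + (1 + cb) * Cexp p))%C.

(* The inverse of [fun w => Cln (disc_quot w)]. *)
Definition disc_of_strip (p : C) : C := joukowski_root (strip_zeta p).

Lemma Cexp_strip_upper (p : C) : pi_strip p -> 0 < Im (Cexp p).
Proof.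
intros [H1 H2]; simpl; apply Rmult_lt_0_compat; [apply exp_pos | now apply sin_gt_0].
Qed.

Lemma half_Cln_quadrant (z : C) : 0 < Im z ->
  0 < Re (Cexp ((/ 2)%R * Cln z)) /\ 0 < Im (Cexp ((/ 2)%R * Cln z)).
Proof.
intros H; assert (A := arg_cut_upper z H).
assert (E : Im ((/ 2)%R * Cln z)%C = arg_cut z / 2)
  by (rewrite im_scal_l; change (Im (Cln z)) with (arg_cut z); field).
split.
- change (0 < exp (Re ((/ 2)%R * Cln z)%C) * cos (Im ((/ 2)%R * Cln z)%C)); rewrite E.
  apply Rmult_lt_0_compat; [apply exp_pos | apply cos_gt_0; lra].
- change (0 < exp (Re ((/ 2)%R * Cln z)%C) * sin (Im ((/ 2)%R * Cln z)%C)); rewrite E.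
  apply Rmult_lt_0_compat; [apply exp_pos | apply sin_gt_0; lra].
Qed.

Lemma half_Cln_sqr (z : C) : 0 < Im z ->
  (Cexp ((/ 2)%R * Cln z) * Cexp ((/ 2)%R * Cln z) = z)%C.
Proof.
intros H; rewrite <- Cexp_plus.
replace ((/ 2)%R * Cln z + (/ 2)%R * Cln z)%C with (Cln z)
  by (apply injective_projections; simpl; field).
apply Cexp_Cln, off_cut_Im; [lra |].
intros ->; simpl in H; lra.
Qed.

Lemma one_minus_i_neq_0 (s : C) : 0 < Im s -> (1 - Ci * s)%C <> 0%C.
Proof.
intros H E; assert (T := f_equal Re E); unfold Re, Im in *; simpl in T; lra.
Qed.

(** The square root of an upper half plane point lies in the first quadrant, and
    [(1 + Ci * s) / (1 - Ci * s)] takes that quadrant into the upper half disc. *)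
Lemma joukowski_root_half_disc (z : C) : 0 < Im z -> half_disc (joukowski_root z).
Proof.
intros H; destruct (half_Cln_quadrant z H) as [H1 H2].
unfold joukowski_root; cbv zeta; set (s := Cexp ((/ 2)%R * Cln z)) in *; clearbody s.
assert (N := one_minus_i_neq_0 s H2); assert (P := norm2_pos _ N).
assert (E : forall x y d, 0 < d -> x / d * (x / d) + y / d * (y / d) = (x * x + y * y) / (d * d))
  by (intros; field; lra).
split; [rewrite Re_div, Im_div by exact N |]; [| rewrite Im_div by exact N].
- rewrite E by exact P.
  apply Rlt_div_l; [apply Rmult_lt_0_compat; exact P |].
  unfold Re, Im in *; simpl in *; revert P; destruct s as [x y]; simpl in *; intros P.
  apply Rlt_0_minus.
  (* This is [|1 - Ci * s|^2 - |1 + Ci * s|^2 = 4 * y], multiplied by [|1 - Ci * s|^2]. *)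
  match goal with |- 0 < ?X =>
    replace X with (4 * y * ((1 + y) * (1 + y) + x * x)) by ring end.
  nra.
- apply Rdiv_lt_0_compat; [| exact P].
  unfold Re, Im in *; simpl in *; nra.
Qed.

(** With [u = Ci * s] one has [u^2 = - z] and [w = (1 + u) / (1 - u)], so that
    [w + / w = 2 * (1 + u^2) / (1 - u^2)]. *)
Lemma joukowski_root_spec (z : C) : 0 < Im z ->
  let w := joukowski_root z in
  ((1 + z) * (w * w + 1) = 2 * (1 - z) * w)%C.
Proof.
intros H w; destruct (half_Cln_quadrant z H) as [H1 H2].
assert (E := half_Cln_sqr z H).
unfold w, joukowski_root; cbv zeta; set (s := Cexp ((/ 2)%R * Cln z)) in *.
assert (N := one_minus_i_neq_0 s H2).
assert (Ei : (Ci * Ci = - (1))%C) by (apply injective_projections; simpl; ring).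
replace z with (- ((Ci * s) * (Ci * s)))%C
  by (rewrite <- E; transitivity (- (Ci * Ci) * (s * s))%C; [ring | rewrite Ei; ring]).
field; exact N.
Qed.

Lemma zeta_den_pos (k l : R) (z : C) : 0 < k -> 0 < Im z -> (l + k * z)%C <> 0%C.
Proof.
intros Hk Hz E; assert (T := f_equal Im E); unfold Im in *; simpl in T; nra.
Qed.

Lemma unit_coord_lt_1 (c s : R) : c * c + s * s = 1 -> 0 < s -> -1 < c < 1.
Proof. intros H1 H2; split; nra. Qed.

Lemma strip_zeta_den (p : C) : pi_strip p -> ((1 + ca) + (1 + cb) * Cexp p)%C <> 0%C.
Proof.
intros Hp; rewrite <- !RtoC_plus; apply zeta_den_pos; [| now apply Cexp_strip_upper].
destruct (unit_coord_lt_1 cb sb Hb Hsb); lra.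
Qed.

(** [strip_zeta] is a real Moebius function of [Cexp p] with determinant [2 * (ca - cb)], positive
    by [Hcab]. *)
Lemma strip_zeta_upper (p : C) : pi_strip p -> 0 < Im (strip_zeta p).
Proof.
intros Hp; assert (N := strip_zeta_den p Hp); assert (P := norm2_pos _ N).
assert (H := Cexp_strip_upper p Hp).
unfold strip_zeta; rewrite Im_div by exact N.
apply Rdiv_lt_0_compat; [| exact P].
set (g := Cexp p) in *; clearbody g; unfold Re, Im in *; simpl in *; nra.
Qed.

Lemma disc_of_strip_half_disc (p : C) : pi_strip p -> half_disc (disc_of_strip p).
Proof. intros Hp; now apply joukowski_root_half_disc, strip_zeta_upper. Qed.

Lemma disc_quot_disc_of_strip (p : C) : pi_strip p -> disc_quot (disc_of_strip p) = Cexp p.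
Proof.
intros Hp; assert (Hw := disc_of_strip_half_disc p Hp).
assert (E := joukowski_root_spec _ (strip_zeta_upper p Hp)); cbv zeta in E.
change (joukowski_root (strip_zeta p)) with (disc_of_strip p) in E.
set (w := disc_of_strip p) in *.
assert (N := quad_neq_0 cb sb Hb Hsb w (half_disc_closed w Hw)
  (half_disc_neq_unit cb sb w Hb Hw)).
assert (Nd := strip_zeta_den p Hp).
unfold strip_zeta in E; set (g := Cexp p) in *.
(* The quadratic equation for [w], cleared of the denominator of [strip_zeta]. *)
assert (E1 : (2 * (quad ca w + g * quad cb w) = 0)%C).
{ transitivity (((1 + ca) + (1 + cb) * g)
    * ((1 + ((1 - ca) + (1 - cb) * g) / ((1 + ca) + (1 + cb) * g)) * (w * w + 1)
       - 2 * (1 - ((1 - ca) + (1 - cb) * g) / ((1 + ca) + (1 + cb) * g)) * w))%C.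
  - unfold quad; field; exact Nd.
  - rewrite E; ring. }
unfold disc_quot.
replace (- quad ca w)%C with (g * quad cb w - / 2 * (2 * (quad ca w + g * quad cb w)))%C
  by (field; apply RtoC_neq_0; lra).
rewrite E1; field; exact N.
Qed.

Lemma Cln_disc_quot_strip (w : C) : half_disc w -> pi_strip (Cln (disc_quot w)).
Proof. intros Hw; now apply arg_cut_upper, disc_quot_upper. Qed.

Lemma Cln_disc_quot_of_strip (p : C) : pi_strip p -> Cln (disc_quot (disc_of_strip p)) = p.
Proof.
intros Hp; rewrite disc_quot_disc_of_strip by exact Hp.
unfold pi_strip in Hp; apply Cln_Cexp; lra.
Qed.

Lemma disc_of_strip_Cln (w : C) : half_disc w -> disc_of_strip (Cln (disc_quot w)) = w.
Proof.
intros Hw; assert (Hp := Cln_disc_quot_strip w Hw).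
apply disc_quot_inj; [now apply disc_of_strip_half_disc | exact Hw |].
rewrite disc_quot_disc_of_strip by exact Hp.
assert (H := disc_quot_upper w Hw).
apply Cexp_Cln, off_cut_Im; [lra |].
intros E; rewrite E in H; simpl in H; lra.
Qed.

Lemma ccont_disc_of_strip (p : C) : pi_strip p -> ccont disc_of_strip p.
Proof.
intros Hp; assert (Hz := strip_zeta_upper p Hp).
apply (ccont_comp joukowski_root strip_zeta).
- apply ccont_div; [| | now apply strip_zeta_den];
    (apply ccont_plus; [apply ccont_const |]; apply ccont_mult;
      [apply ccont_const | exact (cder_cont _ _ _ (cder_Cexp p))]).
- set (z := strip_zeta p) in *.
  assert (Cs : ccont (fun x => Cexp ((/ 2)%R * Cln x)) z).
  { apply (ccont_comp Cexp); [| exact (cder_cont _ _ _ (cder_Cexp _))].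
    apply ccont_mult; [apply ccont_const |].
    apply ccont_Cln, off_cut_Im; [lra |].
    intros E; rewrite E in Hz; simpl in Hz; lra. }
  unfold joukowski_root; cbv zeta.
  apply ccont_div.
  + apply ccont_plus; [apply ccont_const |].
    apply ccont_mult; [apply ccont_const | exact Cs].
  + apply ccont_minus; [apply ccont_const |].
    apply ccont_mult; [apply ccont_const | exact Cs].
  + apply one_minus_i_neq_0; now apply half_Cln_quadrant.
Qed.

Lemma sqr_minus_1_neq_0 (w : C) : half_disc w -> (w * w - 1)%C <> 0%C.
Proof.
intros [H1 H2] E.
replace (w * w - 1)%C with ((w - 1) * (w + 1))%C in E by ring.
revert E; apply Cmult_neq_0; intros E; assert (T := f_equal Im E);
  unfold Im in *; simpl in T; lra.
Qed.

Lemma cder_disc_of_strip (p : C) : pi_strip p ->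
  let w := disc_of_strip p in
  cder disc_of_strip p (/ (2 * (ca - cb) * (w * w - 1) / (quad ca w * quad cb w)))%C.
Proof.
intros Hp w.
assert (Hw := disc_of_strip_half_disc p Hp); fold w in Hw.
assert (Hwc := half_disc_closed w Hw).
assert (Na := half_disc_neq_unit ca sa w Ha Hw).
assert (Nb := half_disc_neq_unit cb sb w Hb Hw).
apply (cder_inverse (fun x => Cln (disc_quot x))).
- now apply cder_ln_disc_quot.
- apply Cmult_neq_0.
  + apply Cmult_neq_0; [| now apply sqr_minus_1_neq_0].
    apply Cmult_neq_0; [apply RtoC_neq_0; lra |].
    rewrite <- RtoC_minus; apply RtoC_neq_0; lra.
  + assert (N : (quad ca w * quad cb w)%C <> 0%C)
      by (apply Cmult_neq_0; [apply (quad_neq_0 ca sa) | apply (quad_neq_0 cb sb)]; auto).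
    intros E; assert (T := Cinv_r _ N); rewrite E, Cmult_0_r in T.
    injection T; lra.
- now apply ccont_disc_of_strip.
- generalize (pi_strip_near p Hp); apply cnear_imp; intros y.
  apply Cln_disc_quot_of_strip.
Qed.

(** * The dam map in the strip coordinate *)

Definition strip_map (p : C) : C := disc_map (disc_of_strip p).

Definition strip_map_der (p : C) : C :=
  let w := disc_of_strip p in ((2 * (hm * sa) / PI)%R * (Ci * w / (w * w - 1)))%C.

Lemma cder_strip_map (p : C) : pi_strip p -> cder strip_map p (strip_map_der p).
Proof.
intros Hp.
assert (Hw := disc_of_strip_half_disc p Hp).
assert (Hwc := half_disc_closed _ Hw).
assert (Na := half_disc_neq_unit ca sa _ Ha Hw).
assert (Nb := half_disc_neq_unit cb sb _ Hb Hw).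
assert (P := PI_RGT_0).
eapply cder_eq.
{ apply (cder_comp disc_map disc_of_strip).
  - now apply cder_disc_of_strip.
  - now apply cder_disc_map. }
cbv zeta; unfold disc_map_der, strip_map_der.
set (w := disc_of_strip p) in *.
assert (Qa := quad_neq_0 ca sa Ha Hsa w Hwc Na).
assert (Qb := quad_neq_0 cb sb Hb Hsb w Hwc Nb).
assert (Q := sqr_minus_1_neq_0 w Hw).
assert (Nc : (ca - cb)%C <> 0%C) by (rewrite <- RtoC_minus; apply RtoC_neq_0; lra).
assert (NP : RtoC PI <> 0%C) by (apply RtoC_neq_0; lra).
rewrite !RtoC_mult, !RtoC_div, !RtoC_mult, RtoC_minus by lra.
field; repeat split; auto; apply RtoC_neq_0; lra.
Qed.

Lemma strip_map_der_Re (p : C) : pi_strip p -> 0 < Re (strip_map_der p).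
Proof.
intros Hp; unfold strip_map_der; cbv zeta.
assert (Hw := disc_of_strip_half_disc p Hp).
set (w := disc_of_strip p) in *.
assert (N := sqr_minus_1_neq_0 w Hw); assert (P := norm2_pos _ N).
rewrite re_scal_l, Re_div by exact N.
assert (0 < hm * sa) by (apply Rmult_lt_0_compat; lra).
apply Rmult_lt_0_compat; [apply Rdiv_lt_0_compat; [lra | apply PI_RGT_0] |].
apply Rdiv_lt_0_compat; [| exact P].
destruct Hw as [H1 H2].
replace (Re (Ci * w)%C * Re (w * w - 1)%C + Im (Ci * w)%C * Im (w * w - 1)%C)
  with (Im w * (1 + (Re w * Re w + Im w * Im w))) by (unfold Re, Im; simpl; ring).
nra.
Qed.

Lemma ccont_strip_map_der (p : C) : pi_strip p -> ccont strip_map_der p.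
Proof.
intros Hp; unfold strip_map_der; cbv zeta.
assert (Cw := ccont_disc_of_strip p Hp).
apply ccont_mult; [apply ccont_const |].
apply ccont_div.
- apply ccont_mult; [apply ccont_const | exact Cw].
- apply ccont_minus; [now apply ccont_mult | apply ccont_const].
- now apply sqr_minus_1_neq_0, disc_of_strip_half_disc.
Qed.

(** * Values on the diameter and on the unit arc *)

Lemma Re_disc_map (w : C) :
  Re (disc_map w) = hm / PI * ln (Cmod (disc_ratio ca sa w))
                    - hp / PI * ln (Cmod (disc_ratio cb sb w)).
Proof.
assert (P := PI_RGT_0); unfold disc_map.
rewrite <- !RtoC_div by lra.
unfold Cln, Re; simpl; ring.
Qed.

Lemma Im_disc_map (w : C) :
  Im (disc_map w) = hm / PI * arg_cut (disc_ratio ca sa w)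
                    - hp / PI * arg_cut (disc_ratio cb sb w) - (hm - hp).
Proof.
assert (P := PI_RGT_0); unfold disc_map.
rewrite <- !RtoC_div by lra.
unfold Cln, Im; simpl; ring.
Qed.

(** Both arguments lie in [(0, PI)], so the first term is positive and the second is greater than
    [- hp]. *)
Lemma disc_map_bottom (w : C) : half_disc w -> - hm < Im (disc_map w).
Proof.
intros [H1 H2]; assert (P := PI_RGT_0); rewrite Im_disc_map.
assert (Ua := arg_disc_ratio_upper ca sa Ha Hsa w (conj H1 H2)).
assert (Ub := arg_disc_ratio_upper cb sb Hb Hsb w (conj H1 H2)).
assert (0 < hm / PI * arg_cut (disc_ratio ca sa w)).
{ apply Rmult_lt_0_compat; [apply Rdiv_lt_0_compat; lra | lra]. }
assert (hp / PI * arg_cut (disc_ratio cb sb w) < hp).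
{ apply Rlt_le_trans with (hp / PI * PI); [| right; field; lra].
  apply Rmult_lt_compat_l; [apply Rdiv_lt_0_compat; lra | lra]. }
lra.
Qed.

Lemma Re_disc_map_real (p : R) : Re (disc_map (p, 0)) = 0.
Proof. rewrite Re_disc_map, !Cmod_disc_ratio_real, ln_1 by assumption; ring. Qed.

(** [(p, q) * Ci] is the tangent of the circle. The product is real because each arc is sent into a
    horizontal line, and its sign is read off from [(p - ca) * (p - cb)]. *)
Lemma disc_map_der_circle (p q : R) : p * p + q * q = 1 -> p <> ca -> p <> cb ->
  (disc_map_der (p, q) * ((p, q)%R * Ci))%C
  = RtoC (- (hm * sa * (ca - cb) / PI) / ((p - ca) * (p - cb))).
Proof.
intros H Na Nb; assert (P := PI_RGT_0); unfold disc_map_der.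
assert (Nw : ((p, q) : C) <> 0%C) by (intros E; injection E; intros; subst; lra).
rewrite !quad_circle by exact H.
set (w := ((p, q) : C)) in *; clearbody w.
assert (Ei : (Ci * Ci = - (1))%C) by (apply injective_projections; simpl; ring).
assert (Na' : (p - ca)%C <> 0%C) by (rewrite <- RtoC_minus; apply RtoC_neq_0; lra).
assert (Nb' : (p - cb)%C <> 0%C) by (rewrite <- RtoC_minus; apply RtoC_neq_0; lra).
assert (Nab : (p - ca) * (p - cb) <> 0) by (apply Rmult_integral_contrapositive; split; lra).
set (k := hm * sa * (ca - cb) / PI).
rewrite RtoC_div, RtoC_opp, !RtoC_mult, !RtoC_minus by exact Nab.
transitivity (- k * (- (Ci * Ci)) / ((p - ca) * (p - cb)))%C; [| rewrite Ei; field; auto].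
transitivity (k * (Ci * Ci) / ((p - ca) * (p - cb)))%C; [field; auto | field; auto].
Qed.

Lemma arc_mean_value (t1 t2 : R) : 0 <= t1 -> t1 < t2 -> t2 <= PI ->
  (forall t, t1 <= t <= t2 -> cos t <> ca /\ cos t <> cb) ->
  exists t, t1 < t < t2 /\
    Re (disc_map (cos t2, sin t2)) - Re (disc_map (cos t1, sin t1))
    = - (hm * sa * (ca - cb) / PI) / ((cos t - ca) * (cos t - cb)) * (t2 - t1).
Proof.
intros H1 H12 H2 Hn.
assert (Ee : forall t : R, Cexp (Ci * t) = (cos t, sin t)).
{ intros t; unfold Cexp; simpl.
  replace (0 * t - 1 * 0) with 0 by ring; replace (0 * 0 + 1 * t) with t by ring.
  rewrite exp_0, !Rmult_1_l; reflexivity. }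
destruct (MVT_cor2 (fun t => Re (1 * disc_map (Cexp (Ci * (0 + t * 1))))%C)
  (fun t => - (hm * sa * (ca - cb) / PI) / ((cos t - ca) * (cos t - cb))) t1 t2)
  as [t [E Ht]]; [exact H12 | |].
- intros t Ht; destruct (Hn t Ht) as [Na Nb].
  assert (Hcirc : cos t * cos t + sin t * sin t = 1)
    by (generalize (sin2_cos2 t); unfold Rsqr; lra).
  replace (- (hm * sa * (ca - cb) / PI) / ((cos t - ca) * (cos t - cb)))
    with (Re (1 * (disc_map_der (cos t, sin t) * ((cos t, sin t)%R * Ci) * 1))%C)
    by (rewrite disc_map_der_circle by assumption; unfold Re; simpl; ring).
  apply (cder_line (fun x => disc_map (Cexp (Ci * x)))).
  replace (0 + t * 1)%C with (RtoC t) by ring.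
  apply (cder_comp disc_map (fun x => Cexp (Ci * x))).
  + replace ((cos t, sin t)%R * Ci)%C with (Cexp (Ci * t) * (Ci * 1))%C
      by (rewrite Ee; ring).
    apply (cder_comp Cexp (fun x => Ci * x)%C); [apply cder_scal, cder_id | apply cder_Cexp].
  + rewrite Ee; apply cder_disc_map.
    * split; simpl; [lra | apply sin_ge_0; lra].
    * intros X; injection X; intros; now apply Na.
    * intros X; injection X; intros; now apply Nb.
- exists t; split; [exact Ht |]; rewrite <- E.
  replace (Ci * (0 + t1 * 1))%C with (Ci * t1)%C by ring.
  replace (Ci * (0 + t2 * 1))%C with (Ci * t2)%C by ring.
  rewrite !Ee, !Cmult_1_l; reflexivity.
Qed.

Lemma slope_pos : 0 < hm * sa * (ca - cb) / PI.
Proof.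
apply Rdiv_lt_0_compat; [| apply PI_RGT_0].
apply Rmult_lt_0_compat; [apply Rmult_lt_0_compat; lra | lra].
Qed.

Lemma circle_acos (p q : R) : 0 < q -> p * p + q * q = 1 ->
  0 < acos p < PI /\ cos (acos p) = p /\ sin (acos p) = q.
Proof.
intros Hq H; assert (Hp : -1 < p < 1) by (split; nra).
split; [apply acos_bound_lt; lra |].
split; [apply cos_acos; lra |].
rewrite sin_acos by lra.
replace (1 - Rsqr p) with (Rsqr q) by (unfold Rsqr; lra).
apply sqrt_Rsqr; lra.
Qed.

(** The real part is 0 at [w = 1] and decreases from there, since [cos t - ca] and [cos t - cb] are
    both positive up to the pole. Thus the right arc lies over [X < 0]; the same argument from
    [w = -1] puts the left arc over [X > 0]. *)
Lemma Re_disc_map_right_arc (p q : R) :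
  0 < q -> p * p + q * q = 1 -> ca < p -> Re (disc_map (p, q)) < 0.
Proof.
intros Hq H L; destruct (circle_acos p q Hq H) as [Ht [Ec Es]].
assert (M : forall t, 0 <= t <= acos p -> p <= cos t).
{ intros t Hts; rewrite <- Ec; apply cos_decr_1; lra. }
destruct (arc_mean_value 0 (acos p)) as [t [Ht1 E]]; try lra.
{ intros t Hts; specialize (M t Hts); split; lra. }
rewrite Ec, Es, cos_0, sin_0, Re_disc_map_real in E.
specialize (M t ltac:(lra)); assert (K := slope_pos).
assert (0 < hm * sa * (ca - cb) / PI / ((cos t - ca) * (cos t - cb)))
  by (apply Rdiv_lt_0_compat; nra).
unfold Rdiv in *; nra.
Qed.

Lemma Re_disc_map_left_arc (p q : R) :
  0 < q -> p * p + q * q = 1 -> p < cb -> 0 < Re (disc_map (p, q)).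
Proof.
intros Hq H L; destruct (circle_acos p q Hq H) as [Ht [Ec Es]].
assert (M : forall t, acos p <= t <= PI -> cos t <= p).
{ intros t Hts; rewrite <- Ec; apply cos_decr_1; lra. }
destruct (arc_mean_value (acos p) PI) as [t [Ht1 E]]; try lra.
{ intros t Hts; specialize (M t Hts); split; lra. }
rewrite Ec, Es, cos_PI, sin_PI, Re_disc_map_real in E.
specialize (M t ltac:(lra)); assert (K := slope_pos).
assert (0 < hm * sa * (ca - cb) / PI / ((cos t - ca) * (cos t - cb)))
  by (apply Rdiv_lt_0_compat; nra).
unfold Rdiv in *; nra.
Qed.

Lemma Im_disc_map_circle (p q : R) : 0 < q -> p * p + q * q = 1 ->
  (ca < p -> Im (disc_map (p, q)) = 0) /\
  (cb < p < ca -> Im (disc_map (p, q)) = - hm) /\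
  (p < cb -> Im (disc_map (p, q)) = - (hm - hp)).
Proof.
intros Hq H; rewrite Im_disc_map; assert (P := PI_RGT_0).
destruct (arg_disc_ratio_circle ca sa Ha Hsa p q ltac:(lra) H) as [A1 A2].
destruct (arg_disc_ratio_circle cb sb Hb Hsb p q ltac:(lra) H) as [B1 B2].
repeat split; intros L.
- rewrite A2, B2 by lra; field; lra.
- rewrite A1, B2 by lra; field; lra.
- rewrite A1, B1 by lra; field; lra.
Qed.

Lemma disc_quot_circle (p q : R) : 0 < q -> p * p + q * q = 1 -> p <> cb ->
  disc_quot (p, q) = RtoC (- ((p - ca) / (p - cb))).
Proof.
intros Hq H Nb; unfold disc_quot; rewrite !quad_circle by exact H.
assert (Nw : ((p, q) : C) <> 0%C) by (intros E; injection E; intros; lra).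
set (w := ((p, q) : C)) in *; clearbody w.
assert (Nb' : (p - cb)%C <> 0%C) by (rewrite <- RtoC_minus; apply RtoC_neq_0; lra).
rewrite RtoC_opp, RtoC_div, !RtoC_minus by lra.
field; auto.
Qed.

Lemma quad_real_pos (c s p : R) : c * c + s * s = 1 -> 0 < s ->
  quad c (p, 0) = RtoC (p * p - 2 * c * p + 1) /\ 0 < p * p - 2 * c * p + 1.
Proof.
intros H Hs; split; [apply injective_projections; simpl; ring |].
assert (0 < s * s) by nra. assert (0 <= (p - c) * (p - c)) by apply Rle_0_sqr. nra.
Qed.

Lemma not_pole (c s : R) (w : C) : c * c + s * s = 1 ->
  Re w * Re w + Im w * Im w < 1 \/ Im w <> s -> w <> (c, s).
Proof. intros H [H1 | H1] ->; simpl in H1; lra. Qed.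

(** * Behaviour near the diameter and near the poles *)

Lemma vertical_mean_value (p q : R) : half_disc (p, q) ->
  exists t, 0 < t < q /\ Re (disc_map (p, q))
    = - (4 * (hm * sa * (ca - cb) / PI)) * Re ((p, t) / (quad ca (p, t) * quad cb (p, t)))%C * q.
Proof.
intros [H1 H2]; simpl in H1, H2.
assert (Ep : forall t : R, ((p, 0)%R + t * Ci)%C = (p, t))
  by (intros t; apply injective_projections; simpl; ring).
destruct (MVT_cor2 (fun t => Re (1 * disc_map ((p, 0)%R + t * Ci))%C)
  (fun t => Re (1 * (disc_map_der (p, t) * Ci))%C) 0 q) as [t [E Ht]]; [exact H2 | |].
- intros t Ht; apply cder_line; rewrite Ep; apply cder_disc_map.
  + split; simpl; nra.
  + apply not_pole; [exact Ha | left; simpl; nra].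
  + apply not_pole; [exact Hb | left; simpl; nra].
- exists t; split; [exact Ht |].
  rewrite !Ep, !Cmult_1_l, Re_disc_map_real in E.
  rewrite Rminus_0_r, Rminus_0_r in E; rewrite E; f_equal.
  unfold disc_map_der, Re; simpl; ring.
Qed.

(** The real part is 0 on the diameter, and its vertical derivative involves [w / (P_a P_b)], which
    is real and nonzero at [(p, 0)]. It therefore leaves 0 with a definite sign, and the level set 0
    cannot accumulate at [p <> 0]. *)
Lemma Re_disc_map_near_real (p : R) : p <> 0 ->
  cnear (p, 0) (fun w => half_disc w -> Re (disc_map w) <> 0).
Proof.
intros Hp.
destruct (quad_real_pos ca sa p Ha Hsa) as [Ea Pa].
destruct (quad_real_pos cb sb p Hb Hsb) as [Eb Pb].
assert (Cq : forall c, ccont (quad c) (p, 0)).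
{ intros c; unfold quad; apply ccont_plus; [| apply ccont_const].
  apply ccont_minus; apply ccont_mult; try apply ccont_id; apply ccont_const. }
set (f := fun w => (w / (quad ca w * quad cb w))%C).
set (r := p / ((p * p - 2 * ca * p + 1) * (p * p - 2 * cb * p + 1))).
assert (Pab : 0 < (p * p - 2 * ca * p + 1) * (p * p - 2 * cb * p + 1))
  by now apply Rmult_lt_0_compat.
assert (Ef : Re (f (p, 0)) = r).
{ unfold f; rewrite Ea, Eb, <- RtoC_mult.
  change ((p, 0) : C) with (RtoC p); rewrite <- RtoC_div by lra; reflexivity. }
assert (Nr : r <> 0).
{ unfold r; intros E; apply Hp.
  replace p with (p / ((p * p - 2 * ca * p + 1) * (p * p - 2 * cb * p + 1))
    * ((p * p - 2 * ca * p + 1) * (p * p - 2 * cb * p + 1))) by (field; lra).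
  rewrite E; ring. }
assert (Cf : ccont f (p, 0)).
{ unfold f; apply ccont_div; [apply ccont_id | now apply ccont_mult |].
  rewrite Ea, Eb, <- RtoC_mult; apply RtoC_neq_0; lra. }
assert (Nf : cnear (p, 0) (fun w => Re (f w) <> 0)).
{ destruct (Rdichotomy _ _ Nr) as [L | L]; rewrite <- Ef in L.
  - generalize (ccont_near _ _ _ Cf (cnear_Re_lt _ _ L)); apply cnear_imp; intros y Hy; lra.
  - generalize (ccont_near _ _ _ Cf (cnear_Re_gt _ _ L)); apply cnear_imp; intros y Hy; lra. }
destruct Nf as [d [hd Hd]]; exists d; split; [exact hd |].
intros [x y] Hxy Hw; destruct (vertical_mean_value x y Hw) as [t [Ht E]]; rewrite E.
assert (K := slope_pos).
apply Rmult_integral_contrapositive; split; [| lra].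
apply Rmult_integral_contrapositive; split; [lra |].
apply (Hd (x, t)).
(* The intermediate point [(x, t)] is closer to [(p, 0)] than [(x, y)], because [0 < t < y]. *)
eapply Rle_lt_trans; [| exact Hxy].
assert (S1 := Cmod_sqr ((x, t) - (p, 0))%C); assert (S2 := Cmod_sqr ((x, y) - (p, 0))%C).
assert (G1 := Cmod_ge_0 ((x, t) - (p, 0))%C); assert (G2 := Cmod_ge_0 ((x, y) - (p, 0))%C).
simpl in S1, S2; apply Rnot_lt_le; intros L; nra.
Qed.

Lemma pole_neq : ((cb, sb) : C) <> (ca, sa).
Proof. intros E; injection E; intros; lra. Qed.

Lemma pole_closed (c s : R) : c * c + s * s = 1 -> 0 < s -> closed_half_disc (c, s).
Proof. intros H Hs; split; simpl; lra. Qed.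

Lemma Re_disc_map_near_left_pole (X : R) :
  cnear (ca, sa) (fun w => half_disc w -> Re (disc_map w) < X).
Proof.
assert (P := PI_RGT_0).
set (l := ln (Cmod (disc_ratio cb sb (ca, sa)))).
(* Chosen so that [hm / PI * T] equals [X] plus a lower bound of the other term, which stays within
   1 of [l] before scaling. *)
set (T := (X + hp / PI * (l - 1)) * PI / hm).
assert (N := not_eq_sym pole_neq).
generalize (cnear_and _ _ _ (ln_disc_ratio_to_minus_infty ca sa Ha Hsa T)
  (ln_disc_ratio_near cb sb Hb Hsb _ (pole_closed ca sa Ha Hsa) N)).
apply cnear_imp; intros w [H1 H2] Hw; specialize (H1 Hw).
fold l in H2; apply Rabs_def2 in H2.
rewrite Re_disc_map.
assert (hm / PI * ln (Cmod (disc_ratio ca sa w)) < X + hp / PI * (l - 1)).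
{ apply Rlt_le_trans with (hm / PI * T); [| right; unfold T; field; lra].
  apply Rmult_lt_compat_l; [apply Rdiv_lt_0_compat; lra | exact H1]. }
assert (hp / PI * (l - 1) < hp / PI * ln (Cmod (disc_ratio cb sb w))).
{ apply Rmult_lt_compat_l; [apply Rdiv_lt_0_compat; lra | lra]. }
lra.
Qed.

Lemma Re_disc_map_near_right_pole (X : R) :
  cnear (cb, sb) (fun w => half_disc w -> X < Re (disc_map w)).
Proof.
assert (P := PI_RGT_0).
set (l := ln (Cmod (disc_ratio ca sa (cb, sb)))).
set (T := (hm / PI * (l - 1) - X) * PI / hp).
generalize (cnear_and _ _ _ (ln_disc_ratio_to_minus_infty cb sb Hb Hsb T)
  (ln_disc_ratio_near ca sa Ha Hsa _ (pole_closed cb sb Hb Hsb) pole_neq)).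
apply cnear_imp; intros w [H1 H2] Hw; specialize (H1 Hw).
fold l in H2; apply Rabs_def2 in H2.
rewrite Re_disc_map.
assert (hp / PI * ln (Cmod (disc_ratio cb sb w)) < hm / PI * (l - 1) - X).
{ apply Rlt_le_trans with (hp / PI * T); [| right; unfold T; field; lra].
  apply Rmult_lt_compat_l; [apply Rdiv_lt_0_compat; lra | exact H1]. }
assert (hm / PI * (l - 1) < hm / PI * ln (Cmod (disc_ratio ca sa w))).
{ apply Rmult_lt_compat_l; [apply Rdiv_lt_0_compat; lra | lra]. }
lra.
Qed.

Lemma Cmod_half_disc (w : C) : half_disc w -> Cmod w < 1.
Proof. intros [H _]; assert (S := Cmod_sqr w); assert (G := Cmod_ge_0 w); nra. Qed.

Lemma Cmod_quad_le (c s : R) (w : C) : c * c + s * s = 1 -> half_disc w -> Cmod (quad c w) <= 4.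
Proof.
intros H Hw; assert (L := Cmod_half_disc w Hw); assert (G := Cmod_ge_0 w).
rewrite (quad_factor c s H), Cmod_mult.
assert (U : forall t : R, t * t = s * s -> Cmod (w - (c, t))%C <= 2).
{ intros t Ht.
  assert (S := Cmod_sqr (c, t)); assert (G1 := Cmod_ge_0 (c, t)); simpl in S.
  assert (Cmod (c, t) <= 1) by nra.
  assert (T := Cmod_triangle w (- (c, t)%R)); rewrite Cmod_opp in T.
  unfold Cminus; lra. }
assert (U1 := U s eq_refl); assert (U2 := U (- s) ltac:(ring)).
assert (V1 := Cmod_ge_0 (w - (c, s)%R)%C); assert (V2 := Cmod_ge_0 (w - (c, - s)%R)%C).
nra.
Qed.

(** The factor at the conjugate root has imaginary part at least [s]. A small value of [quad] thus
    forces [w] close to the pole, which turns [Re p] large into nearness to a pole. *)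
Lemma Cmod_quad_ge (c s : R) (w : C) : c * c + s * s = 1 -> 0 < s -> half_disc w ->
  Cmod (w - (c, s)%R)%C * s <= Cmod (quad c w).
Proof.
intros H Hs [_ Hw]; rewrite (quad_factor c s H), Cmod_mult.
apply Rmult_le_compat_l; [apply Cmod_ge_0 |].
eapply Rle_trans; [| apply im_le_Cmod].
eapply Rle_trans; [| apply Rle_abs].
unfold Im in *; simpl; lra.
Qed.

Lemma Cmod_disc_quot_of_strip (x y : R) : 0 < y < PI ->
  let w := disc_of_strip (x, y) in Cmod (quad ca w) = exp x * Cmod (quad cb w).
Proof.
intros Hy w.
assert (Hw := disc_of_strip_half_disc (x, y) Hy); fold w in Hw.
assert (Pb := quad_neq_0 cb sb Hb Hsb w (half_disc_closed w Hw)
  (half_disc_neq_unit cb sb w Hb Hw)).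
assert (E := disc_quot_disc_of_strip (x, y) Hy); fold w in E.
assert (T := f_equal Cmod E); rewrite Cmod_Cexp in T; simpl in T.
unfold disc_quot in T; rewrite Cmod_div, Cmod_opp in T by exact Pb.
rewrite <- T; field; intros Z; apply Pb, Cmod_eq_0, Z.
Qed.

Lemma strip_map_wide (X y : R) : 0 < y < PI ->
  (exists x, Re (strip_map (x, y)) < X) /\ (exists x, X < Re (strip_map (x, y))).
Proof.
intros Hy; split.
- destruct (Re_disc_map_near_left_pole X) as [d [hd Hd]].
  (* [Cmod_quad_le] gives [|P_a| = exp x * |P_b| <= 4 * exp x]; dividing by 5 makes the resulting
     bound strictly below [d * sa]. *)
  assert (Hr : 0 < d * sa / 5) by (apply Rdiv_lt_0_compat; [now apply Rmult_lt_0_compat | lra]).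
  set (x := ln (d * sa / 5)); exists x; apply Hd; [| now apply disc_of_strip_half_disc].
  assert (Hw := disc_of_strip_half_disc (x, y) Hy).
  assert (E := Cmod_disc_quot_of_strip x y Hy); cbv zeta in E.
  set (w := disc_of_strip (x, y)) in *.
  unfold x in E; rewrite exp_ln in E by exact Hr.
  assert (L := Cmod_quad_ge ca sa w Ha Hsa Hw); assert (U := Cmod_quad_le cb sb w Hb Hw).
  rewrite E in L; apply (Rmult_lt_reg_r sa); [exact Hsa |]; nra.
- destruct (Re_disc_map_near_right_pole X) as [d [hd Hd]].
  assert (Hr : 0 < d * sb / 5) by (apply Rdiv_lt_0_compat; [now apply Rmult_lt_0_compat | lra]).
  set (x := - ln (d * sb / 5)); exists x; apply Hd; [| now apply disc_of_strip_half_disc].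
  assert (Hw := disc_of_strip_half_disc (x, y) Hy).
  assert (E := Cmod_disc_quot_of_strip x y Hy); cbv zeta in E.
  set (w := disc_of_strip (x, y)) in *.
  unfold x in E; rewrite exp_Ropp, exp_ln in E by exact Hr.
  assert (L := Cmod_quad_ge cb sb w Hb Hsb Hw); assert (U := Cmod_quad_le ca sa w Ha Hw).
  assert (E1 : Cmod (quad cb w) = d * sb / 5 * Cmod (quad ca w)) by (rewrite E; field; nra).
  rewrite E1 in L; apply (Rmult_lt_reg_r sb); [exact Hsb |]; nra.
Qed.

(** * Limits at the two edges along a level set *)

Context (h : R) (Hh : 0 < h) (Hdam : 0 < hm - hp + h)
  (Htip : Im (disc_map 0) = - (hm - hp + h)).

Lemma u_tilde_neg (x : R) : x < 0 -> u_tilde hm hp h x = 0.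
Proof. intros H; unfold u_tilde; destruct (total_order_T x 0) as [[L | L] | L]; lra. Qed.

Lemma u_tilde_zero : u_tilde hm hp h 0 = - (hm - hp + h).
Proof. unfold u_tilde; destruct (total_order_T 0 0) as [[L | L] | L]; lra. Qed.

Lemma u_tilde_pos (x : R) : 0 < x -> u_tilde hm hp h x = - (hm - hp).
Proof. intros H; unfold u_tilde; destruct (total_order_T x 0) as [[L | L] | L]; lra. Qed.

(* The behaviour of [disc_map] near [w0] on the level set [Re = X], where the
   coordinate [arg_cut (disc_quot w)] tends to [PI] or to [0]. *)
Definition level_limit (X e : R) (w0 : C) (d : R) : Prop :=
  forall w, half_disc w -> Cmod (w - w0)%C < d -> Re (disc_map w) = X ->
    (PI - d < arg_cut (disc_quot w) -> Rabs (Im (disc_map w) - u_tilde hm hp h X) < e) /\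
    (arg_cut (disc_quot w) < d -> Im (disc_map w) < - hm + e).

Lemma level_limit_excluded (X e : R) (w0 : C) :
  cnear w0 (fun w => half_disc w -> Re (disc_map w) <> X) ->
  exists d, 0 < d /\ level_limit X e w0 d.
Proof.
intros [d [hd Hd]]; exists d; split; [exact hd |].
intros w Hw Hn E; now destruct (Hd w Hn Hw).
Qed.

(** At a point of continuity each implication holds for one of two reasons: the strip coordinate
    stays away from the edge in question, or [Im (disc_map w)] already has the prescribed limit
    there. *)
Lemma level_limit_regular (X e : R) (w0 : C) :
  0 < e -> closed_half_disc w0 -> w0 <> (ca, sa) -> w0 <> (cb, sb) ->
  (Re (disc_map w0) = X ->
    (arg_cut (disc_quot w0) < PI \/ Im (disc_map w0) = u_tilde hm hp h X) /\
    (0 < arg_cut (disc_quot w0) \/ Im (disc_map w0) = - hm)) ->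
  exists d, 0 < d /\ level_limit X e w0 d.
Proof.
intros He Hw Na Nb Hv.
assert (Cd := cder_cont _ _ _ (cder_disc_map w0 Hw Na Nb)).
assert (Cg := cder_cont _ _ _ (cder_ln_disc_quot w0 Hw Na Nb)).
destruct (Req_dec (Re (disc_map w0)) X) as [E | N].
- destruct (Hv E) as [Ht Hb0].
  assert (Ntop : exists d, 0 < d /\ cnear w0 (fun w => PI - d < arg_cut (disc_quot w) ->
     Rabs (Im (disc_map w) - u_tilde hm hp h X) < e)).
  { destruct Ht as [L | L].
    - set (d := (PI - arg_cut (disc_quot w0)) / 2).
      exists d; split; [unfold d; lra |].
      assert (L1 : Im (Cln (disc_quot w0)) < PI - d).
      { change (arg_cut (disc_quot w0) < PI - d); unfold d; lra. }
      generalize (ccont_near _ _ _ Cg (cnear_Im_lt _ _ L1)); apply cnear_imp.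
      intros w A B; change (arg_cut (disc_quot w) < PI - d) in A; lra.
    - exists 1; split; [lra |].
      generalize (Cd e He); apply cnear_imp; intros w A _; rewrite <- L.
      eapply Rle_lt_trans; [| exact A].
      apply (im_le_Cmod (disc_map w - disc_map w0)%C). }
  assert (Nbot : exists d, 0 < d /\ cnear w0 (fun w => arg_cut (disc_quot w) < d ->
     Im (disc_map w) < - hm + e)).
  { destruct Hb0 as [L | L].
    - exists (arg_cut (disc_quot w0) / 2); split; [lra |].
      assert (L1 : arg_cut (disc_quot w0) / 2 < Im (Cln (disc_quot w0))).
      { change (arg_cut (disc_quot w0) / 2 < arg_cut (disc_quot w0)); lra. }
      generalize (ccont_near _ _ _ Cg (cnear_Im_gt _ _ L1)); apply cnear_imp.
      intros w A B; change (arg_cut (disc_quot w0) / 2 < arg_cut (disc_quot w)) in A; lra.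
    - exists 1; split; [lra |].
      assert (L1 : Im (disc_map w0) < - hm + e) by lra.
      generalize (ccont_near _ _ _ Cd (cnear_Im_lt _ _ L1)); apply cnear_imp; auto. }
  destruct Ntop as [d1 [h1 [r1 [k1 R1]]]], Nbot as [d2 [h2 [r2 [k2 R2]]]].
  set (d := Rmin (Rmin d1 r1) (Rmin d2 r2)).
  assert (Dd : d <= d1 /\ d <= r1 /\ d <= d2 /\ d <= r2)
    by (unfold d, Rmin; repeat destruct Rle_dec; lra).
  exists d; split; [repeat apply Rmin_glb_lt; lra |].
  intros w _ Hn _; split; intros A.
  + apply R1; lra.
  + apply R2; lra.
- apply level_limit_excluded.
  destruct (Rdichotomy _ _ N) as [L | L].
  + generalize (ccont_near _ _ _ Cd (cnear_Re_lt _ _ L)); apply cnear_imp; intros y Hy _; lra.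
  + generalize (ccont_near _ _ _ Cd (cnear_Re_gt _ _ L)); apply cnear_imp; intros y Hy _; lra.
Qed.

Lemma not_closed_half_disc_near (w0 : C) :
  ~ closed_half_disc w0 -> cnear w0 (fun w => ~ half_disc w).
Proof.
intros N.
destruct (Rlt_or_le (Im w0) 0) as [L | L].
- generalize (cnear_Im_lt _ _ L); apply cnear_imp; intros w A [_ B]; lra.
- assert (G : 1 < Cmod w0).
  { assert (S := Cmod_sqr w0); assert (P := Cmod_ge_0 w0).
    apply Rnot_le_lt; intros Z; apply N; split; [nra | exact L]. }
  exists (Cmod w0 - 1); split; [lra |]; intros w A B.
  apply Cmod_half_disc in B.
  assert (T := Cmod_triangle w (- (w - w0))%C); rewrite Cmod_opp in T.
  replace (w + - (w - w0))%C with w0 in T by ring; lra.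
Qed.

Lemma level_limit_exists (X e : R) (w0 : C) :
  0 < e -> exists d, 0 < d /\ level_limit X e w0 d.
Proof.
intros He; assert (P := PI_RGT_0).
destruct (excluded_middle_informative (closed_half_disc w0)) as [Hw | N].
2:{ destruct (not_closed_half_disc_near w0 N) as [d [hd Hd]]; exists d; split; [exact hd |].
    intros w Hw Hn; now destruct (Hd w Hn). }
destruct (excluded_middle_informative (w0 = (ca, sa))) as [-> | Na].
{ apply level_limit_excluded; generalize (Re_disc_map_near_left_pole X).
  apply cnear_imp; intros w A B; specialize (A B); lra. }
destruct (excluded_middle_informative (w0 = (cb, sb))) as [-> | Nb].
{ apply level_limit_excluded; generalize (Re_disc_map_near_right_pole X).
  apply cnear_imp; intros w A B; specialize (A B); lra. }
destruct w0 as [p q]; assert (Hw0 := Hw); destruct Hw as [H1 H2]; simpl in H1, H2.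
destruct (Rle_lt_or_eq_dec _ _ H2) as [Hq | <-].
- destruct (Rle_lt_or_eq_dec _ _ H1) as [Hr | Hr].
  + apply level_limit_regular; try assumption; intros _.
    assert (A := arg_cut_upper _ (disc_quot_upper (p, q) (conj Hr Hq))).
    split; left; lra.
  + destruct (Im_disc_map_circle p q Hq Hr) as [V1 [V2 V3]].
    assert (Nca : p <> ca).
    { intros ->; apply Na; f_equal; nra. }
    assert (Ncb : p <> cb).
    { intros ->; apply Nb; f_equal; nra. }
    assert (Eq := disc_quot_circle p q Hq Hr Ncb).
    assert (Hquo : (ca < p \/ p < cb -> arg_cut (disc_quot (p, q)) = PI) /\
                   (cb < p < ca -> arg_cut (disc_quot (p, q)) = 0)).
    (* Multiplication by [(p - cb)^2] turns the quotient into [- (p - ca) * (p - cb)], whose sign is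
       read without division. *)
    { assert (Ex : forall r, p - cb <> 0 -> r = - ((p - ca) / (p - cb)) ->
        r * ((p - cb) * (p - cb)) = - ((p - ca) * (p - cb)))
        by (intros r Hnz ->; field; exact Hnz).
      specialize (Ex _ ltac:(lra) eq_refl).
      assert (0 < (p - cb) * (p - cb)) by nra.
      rewrite Eq; split; intros L.
      - apply arg_cut_neg_real.
        assert (0 < (p - ca) * (p - cb)) by (destruct L; nra). nra.
      - apply arg_cut_pos_real.
        assert ((p - ca) * (p - cb) < 0) by nra. nra. }
    destruct Hquo as [G1 G2].
    apply level_limit_regular; try assumption; intros E.
    destruct (Rlt_or_le ca p) as [L | L].
    * assert (S := Re_disc_map_right_arc p q Hq Hr L); rewrite E in S.
      rewrite u_tilde_neg, V1, G1 by auto; split; [now right | left; lra].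
    * destruct (Rlt_or_le p cb) as [L1 | L1].
      -- assert (S := Re_disc_map_left_arc p q Hq Hr L1); rewrite E in S.
         rewrite u_tilde_pos, V3, G1 by auto; split; [now right | left; lra].
      -- rewrite V2, G2 by lra; split; [left; lra | now right].
(* On the diameter the real part is 0: levels [X <> 0] stay away by continuity, and the level 0 is
   kept from every [p <> 0] by [Re_disc_map_near_real]. *)
- destruct (Req_dec p 0) as [-> | Np].
  + apply level_limit_regular; try assumption; intros E.
    rewrite Re_disc_map_real in E; subst X; split.
    * right; rewrite u_tilde_zero; exact Htip.
    (* [disc_quot 0 = -1], so the tip sits on the upper edge, away from the lower one. *)
    * left; destruct (quad_real_pos ca sa 0 Ha Hsa) as [Ea Pa].
      destruct (quad_real_pos cb sb 0 Hb Hsb) as [Eb Pb].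
      unfold disc_quot; rewrite Ea, Eb, <- RtoC_opp, <- RtoC_div by lra.
      rewrite arg_cut_neg_real; [exact P |].
      replace (- (0 * 0 - 2 * ca * 0 + 1) / (0 * 0 - 2 * cb * 0 + 1)) with (- (1)) by field.
      lra.
  + destruct (Req_dec X 0) as [-> | NX].
    * now apply level_limit_excluded, Re_disc_map_near_real.
    * apply level_limit_regular; try assumption.
      intros E; rewrite Re_disc_map_real in E; now destruct NX.
Qed.

Lemma strip_map_limits (X e : R) : 0 < e -> exists d, 0 < d /\
  forall p, pi_strip p -> Re (strip_map p) = X ->
    (PI - d < Im p -> Rabs (Im (strip_map p) - u_tilde hm hp h X) < e) /\
    (Im p < d -> Im (strip_map p) < - hm + e).
Proof.
intros He.
(* The compactness lemma works with squares; a square of half side [d] lies in the ball of radius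
   [2 * d]. *)
assert (S : forall x y : R, {d : posreal | level_limit X e (x, y) (2 * d)}).
{ intros x y; apply constructive_indefinite_description.
  destruct (level_limit_exists X e (x, y) He) as [d [hd Hd]].
  exists (mkposreal (d / 2) ltac:(lra)); simpl.
  now replace (2 * (d / 2)) with d by field. }
destruct (compactness_value_2d (-1) 1 0 1 (fun x y => proj1_sig (S x y))) as [d Hd].
exists d; split; [apply cond_pos |]; intros p Hp E.
assert (Hw := disc_of_strip_half_disc p Hp).
assert (Ep := Cln_disc_quot_of_strip p Hp).
assert (Ea : arg_cut (disc_quot (disc_of_strip p)) = Im p) by (rewrite <- Ep at 2; reflexivity).
unfold strip_map in *; destruct (disc_of_strip p) as [x y].
assert (Hx : -1 <= x <= 1) by (destruct Hw as [A B]; simpl in *; split; nra).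
assert (Hy : 0 <= y <= 1) by (destruct Hw as [A B]; simpl in *; split; nra).
(* The covering point is supplied only under a double negation. *)
apply NNPP; intros F; apply (Hd x y Hx Hy); intros [u [v [_ [_ [Du [Dv Dd]]]]]]; apply F.
destruct (S u v) as [r Hr]; simpl in *.
assert (Hn : Cmod ((x, y) - (u, v))%C < 2 * r).
{ eapply Rle_lt_trans; [apply Cmod_le_abs |].
  change (Rabs (x - u) + Rabs (y - v) < 2 * r); lra. }
destruct (Hr (x, y) Hw Hn E) as [A B]; rewrite Ea in A, B.
assert (Pr := cond_pos r).
split; intros L; [apply A | apply B]; lra.
Qed.

(** * The map onto the degenerate region and its inverse *)

Lemma disc_map_into (w : C) : half_disc w -> Omega_tilde hm hp h (disc_map w).
Proof.
intros Hw; split; [now apply disc_map_bottom |].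
assert (Hp := Cln_disc_quot_strip w Hw).
assert (T := strip_into strip_map strip_map_der cder_strip_map strip_map_der_Re
  strip_map_wide (- hm) (u_tilde hm hp h) strip_map_limits _ Hp).
unfold strip_map in T; now rewrite disc_of_strip_Cln in T.
Qed.

Lemma strip_map_onto (z : C) :
  Omega_tilde hm hp h z -> exists p, pi_strip p /\ strip_map p = z.
Proof.
exact (strip_onto strip_map strip_map_der cder_strip_map strip_map_der_Re
  strip_map_wide (- hm) (u_tilde hm hp h) strip_map_limits z).
Qed.

(** [u_tilde] is lower semicontinuous: constant on each side of 0 and, by [Hh] and [Hdam], smallest
    at 0, so points below the tip stay below the graph on both sides. *)
Lemma Omega_tilde_near (z : C) :
  Omega_tilde hm hp h z -> cnear z (Omega_tilde hm hp h).
Proof.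
intros [H1 H2].
assert (Tip : forall x, - (hm - hp + h) <= u_tilde hm hp h x).
{ intros x; unfold u_tilde; destruct (total_order_T x 0) as [[L | L] | L]; lra. }
assert (B := cnear_Im_gt _ _ H1); assert (T := cnear_Im_lt _ _ H2).
destruct (Rtotal_order (Re z) 0) as [L | [L | L]].
- generalize (cnear_and _ _ _ B (cnear_and _ _ _ T (cnear_Re_lt _ _ L))); apply cnear_imp.
  intros y [A1 [A2 A3]]; split; [exact A1 |].
  rewrite u_tilde_neg in * by assumption; exact A2.
- generalize (cnear_and _ _ _ B T); apply cnear_imp; intros y [A1 A2]; split; [exact A1 |].
  rewrite L, u_tilde_zero in A2; specialize (Tip (Re y)); lra.
- generalize (cnear_and _ _ _ B (cnear_and _ _ _ T (cnear_Re_gt _ _ L))); apply cnear_imp.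
  intros y [A1 [A2 A3]]; split; [exact A1 |].
  rewrite u_tilde_pos in * by assumption; exact A2.
Qed.

(** A preimage is chosen pointwise; [strip_inverse_continuous] makes the choice continuous, and the
    nonzero derivative of [strip_map] makes it differentiable. *)
Lemma strip_map_inverse : exists g : C -> C,
  (forall z, Omega_tilde hm hp h z -> pi_strip (g z) /\ strip_map (g z) = z) /\
  (forall z, Omega_tilde hm hp h z -> exists l, cder g z l).
Proof.
assert (Hex : forall z, exists p, Omega_tilde hm hp h z -> pi_strip p /\ strip_map p = z).
{ intros z; destruct (excluded_middle_informative (Omega_tilde hm hp h z)) as [Hz | N].
  - destruct (strip_map_onto z Hz) as [p Hp]; now exists p.
  (* Default value outside the region. *)
  - exists 0%C; intros Hz; now destruct N. }
set (g := fun z => proj1_sig (constructive_indefinite_description _ (Hex z))).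
assert (Hg : forall z, Omega_tilde hm hp h z -> pi_strip (g z) /\ strip_map (g z) = z).
{ intros z Hz; unfold g; destruct constructive_indefinite_description as [p Hp]; now apply Hp. }
exists g; split; [exact Hg |].
intros z Hz; destruct (Hg z Hz) as [Gs Ge]; exists (/ strip_map_der (g z))%C.
apply (cder_inverse strip_map).
- now apply cder_strip_map.
- intros E; assert (P := strip_map_der_Re _ Gs); rewrite E in P; simpl in P; lra.
- intros e He.
  destruct (strip_inverse_continuous strip_map strip_map_der cder_strip_map strip_map_der_Re
    ccont_strip_map_der (g z) e Gs He) as [n [Hn Hc]].
  assert (Nn : cnear z (fun y => Cmod (y - z)%C < n)) by (exists n; auto).
  generalize (cnear_and _ _ _ (Omega_tilde_near z Hz) Nn); apply cnear_imp.
  intros y [Hy Hyn]; destruct (Hg y Hy) as [Gys Gye].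
  apply Hc; [exact Gys | now rewrite Gye, Ge].
- generalize (Omega_tilde_near z Hz); apply cnear_imp; intros y Hy; apply Hg, Hy.
Qed.

End HalfDiscMap.

(** * Return to the half strip *)

Lemma Cexp_imag (t : R) : Cexp (0, t) = (cos t, sin t).
Proof. unfold Cexp; simpl; rewrite exp_0, !Rmult_1_l; reflexivity. Qed.

Lemma Csinh_imag (t : R) : Csinh (0, t) = (0, sin t).
Proof.
unfold Csinh; rewrite Cexp_opp, Cexp_imag.
assert (E : (/ (cos t, sin t)%R)%C = (cos t, - sin t)).
{ rewrite <- Cexp_imag, <- Cexp_opp.
  replace (- (0, t)%R)%C with ((0, - t) : C) by (apply injective_projections; simpl; ring).
  now rewrite Cexp_imag, cos_neg, sin_neg. }
rewrite E.
replace ((cos t, sin t)%R - (cos t, - sin t)%R)%C with (2 * (0, sin t)%R)%C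
  by (apply injective_projections; simpl; ring).
field; apply RtoC_neq_0; lra.
Qed.

Lemma strip_half_disc (z : C) : strip z -> half_disc (Cexp (2 * z)).
Proof.
intros [H1 [H2 H3]].
assert (Er : Re (2 * z)%C = 2 * Re z) by (unfold Re; simpl; ring).
assert (Ei : Im (2 * z)%C = 2 * Im z) by (unfold Im; simpl; ring).
split.
- rewrite <- Cmod_sqr, Cmod_Cexp, Er, <- exp_plus.
  rewrite <- exp_0; apply exp_increasing; lra.
- change (0 < exp (Re (2 * z)%C) * sin (Im (2 * z)%C)); rewrite Ei.
  apply Rmult_lt_0_compat; [apply exp_pos | apply sin_gt_0; lra].
Qed.

Lemma half_disc_off_cut (w : C) : half_disc w -> ~ neg_imag_halfline w.
Proof. intros [_ H] [_ H1]; lra. Qed.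

Lemma half_Cln_strip (w : C) : half_disc w -> strip ((/ 2)%R * Cln w)%C.
Proof.
intros Hw; assert (L := Cmod_half_disc w Hw); assert (N := half_disc_off_cut w Hw).
assert (A := arg_cut_upper w (proj2 Hw)); destruct (off_cut_pos w N) as [P _].
unfold strip; rewrite re_scal_l, im_scal_l; change (Re (Cln w)) with (ln (Cmod w)).
change (Im (Cln w)) with (arg_cut w).
assert (ln (Cmod w) < 0) by (rewrite <- ln_1; now apply ln_increasing).
lra.
Qed.

Lemma half_Cln_Cexp (z : C) : strip z -> ((/ 2)%R * Cln (Cexp (2 * z)))%C = z.
Proof.
intros [H1 [H2 H3]]; assert (P := PI_RGT_0).
assert (Ei : Im (2 * z)%C = 2 * Im z) by (unfold Im; simpl; ring).
rewrite Cln_Cexp by (rewrite Ei; lra).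
apply injective_projections; simpl; field.
Qed.

Lemma Cexp_half_Cln (w : C) : half_disc w -> Cexp (2 * ((/ 2)%R * Cln w)) = w.
Proof.
intros Hw.
replace (2 * ((/ 2)%R * Cln w))%C with (Cln w) by (apply injective_projections; simpl; field).
now apply Cexp_Cln, half_disc_off_cut.
Qed.

Lemma strip_near (z : C) : strip z -> cnear z strip.
Proof.
intros [H1 [H2 H3]].
exact (cnear_and _ _ _ (cnear_Re_lt _ _ H1)
  (cnear_and _ _ _ (cnear_Im_gt _ _ H2) (cnear_Im_lt _ _ H3))).
Qed.

(** With [X = Cexp z] and [Y = Cexp (0, a)], numerator and denominator are both multiplied by
    [2 * X / Y], which leaves a Moebius function of [X^2] with parameter [/ Y^2]. *)
Lemma sinh_ratio (a : R) (z : C) : 0 < sin (2 * a) -> strip z ->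
  (Csinh (z - (0, a)%R) / Csinh (z + (0, a)%R))%C
  = disc_ratio (cos (2 * a)) (sin (2 * a)) (Cexp (2 * z)).
Proof.
intros Hs Hz.
assert (Hw := strip_half_disc z Hz).
assert (N := sub_pole_neq_0 (cos (2 * a)) (sin (2 * a)) Hs (Cexp (2 * z))
  (Rlt_le _ _ (proj2 Hw))).
assert (Ep : ((cos (2 * a), - sin (2 * a)) : C) = (/ (Cexp (0, a) * Cexp (0, a)))%C).
{ rewrite <- Cexp_plus, <- Cexp_opp.
  replace (- ((0, a)%R + (0, a)%R))%C with ((0, - (2 * a)) : C)
    by (apply injective_projections; simpl; ring).
  now rewrite Cexp_imag, cos_neg, sin_neg. }
unfold disc_ratio; rewrite Ep in *.
replace (2 * z)%C with (z + z)%C in * by ring.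
change (z - (0, a)%R)%C with (z + - (0, a)%R)%C.
unfold Csinh; rewrite !Cexp_opp, !Cexp_plus, !Cexp_opp in *.
assert (NX := Cexp_neq_0 z); assert (NY := Cexp_neq_0 (0, a)).
set (X := Cexp z) in *; set (Y := Cexp (0, a)) in *; clearbody X Y.
assert (N1 : (X * X * (Y * Y) - 1)%C <> 0%C).
{ intros E; apply N.
  replace (X * X - / (Y * Y))%C with ((X * X * (Y * Y) - 1) / (Y * Y))%C by (field; auto).
  rewrite E; field; auto. }
assert (N2 : RtoC 2 <> 0%C) by (apply RtoC_neq_0; lra).
field; repeat split; auto.
Qed.

(** At [w = 0] the ratio is [exp (2 i a)], and [2 * a] lies in the window of the branch. These two
    values, for [a] and [b], determine the tip. *)
Lemma Cln_disc_ratio_0 (a : R) : 0 < a < PI / 2 ->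
  Cln (disc_ratio (cos (2 * a)) (sin (2 * a)) 0) = (0, 2 * a).
Proof.
intros H.
assert (Hcs : cos (2 * a) * cos (2 * a) + sin (2 * a) * sin (2 * a) = 1)
  by (generalize (sin2_cos2 (2 * a)); unfold Rsqr; lra).
assert (Hs : 0 < sin (2 * a)) by (apply sin_gt_0; lra).
replace (disc_ratio (cos (2 * a)) (sin (2 * a)) 0) with (Cexp (0, 2 * a)).
- apply Cln_Cexp; simpl; lra.
- rewrite Cexp_imag; unfold disc_ratio.
  assert (N := pole_neq_0 (cos (2 * a)) _ Hs); assert (E := pole_conj _ _ Hcs).
  set (e := ((cos (2 * a), - sin (2 * a)) : C)) in *.
  set (f := ((cos (2 * a), sin (2 * a)) : C)) in *; clearbody e f.
  transitivity (e * f / e)%C; [field; exact N | rewrite E; field].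
  replace (0 - e)%C with (- e)%C by ring.
  intros Z; apply N; replace e with (- - e)%C by ring; rewrite Z; ring.
Qed.

Theorem mainTheorem3 (hm hp h : R) (D zm zp : C)
  (hm_pos : 0 < hm) (hp_pos : 0 < hp) (h_pos : 0 < h)
  (h_lt_hp : h < hp) (dam_pos : hm - hp + h > 0)
  (zm_seg : open_segment_ipi2 zm) (zp_seg : open_segment_ipi2 zp)
  (eq1 : (D + 2 * hm * zm / (3 * PI) - 2 * hp * zp / (3 * PI) = 0)%C)
  (eq2 : (hm * zm - hp * zp = - (Ci * h * PI / 2))%C)
  (eq3 : (hm * Csinh (2 * zm) = hp * Csinh (2 * zp))%C) :
  biholomorphic_onto strip (Omega_tilde hm hp h) (Q_tilde hm hp D zm zp).
Proof.
assert (P := PI_RGT_0).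
unfold Q_tilde; rewrite eq1; clear eq1 D.
destruct zm as [z1 a], zp as [z2 b], zm_seg as [E1 Ha], zp_seg as [E2 Hb].
simpl in E1, E2, Ha, Hb; subst z1 z2.
assert (H2 : hp * b - hm * a = h * PI / 2).
{ assert (E : ((hm * (0, a)%R - hp * (0, b)%R) * 2 = - (Ci * h * PI))%C)
    by (rewrite eq2; field; apply RtoC_neq_0; lra).
  assert (T := f_equal Im E); unfold Im in T; simpl in T; lra. }
assert (H3 : hm * sin (2 * a) = hp * sin (2 * b)).
{ replace (2 * (0, a)%R)%C with ((0, 2 * a) : C) in eq3
    by (apply injective_projections; simpl; ring).
  replace (2 * (0, b)%R)%C with ((0, 2 * b) : C) in eq3
    by (apply injective_projections; simpl; ring).
  rewrite !Csinh_imag in eq3.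
  assert (T := f_equal Im eq3); unfold Im in T; simpl in T; lra. }
clear eq2 eq3.
(* If [b <= a], then [hm * a < hp * b] (from [h > 0]) forces [hm < hp], while
   [hp * (PI / 2 - b) < hm * (PI / 2 - a)] (from [dam_pos]) forces [hp < hm]. *)
assert (Hab : a < b).
{ assert (hp * (PI / 2 - b) < hm * (PI / 2 - a)) by nra.
  assert (hm * a < hp * b) by nra.
  apply Rnot_le_lt; intros L; assert (hm < hp) by nra; nra. }
set (ca := cos (2 * a)); set (sa := sin (2 * a)).
set (cb := cos (2 * b)); set (sb := sin (2 * b)).
assert (Hsa : 0 < sa) by (apply sin_gt_0; lra).
assert (Hsb : 0 < sb) by (apply sin_gt_0; lra).
assert (Hca : ca * ca + sa * sa = 1)
  by (generalize (sin2_cos2 (2 * a)); unfold Rsqr, ca, sa; lra).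
assert (Hcb : cb * cb + sb * sb = 1)
  by (generalize (sin2_cos2 (2 * b)); unfold Rsqr, cb, sb; lra).
assert (Hc : cb < ca) by (apply cos_decreasing_1; lra).
set (f := disc_map hm hp ca sa cb sb).
(* The arguments at 0 are [2 * a] and [2 * b], so [H2] turns the logarithmic part into [- h]. *)
assert (Htip : Im (f 0) = - (hm - hp + h)).
{ unfold f; rewrite Im_disc_map by assumption.
  change (hm / PI * Im (Cln (disc_ratio ca sa 0)) - hp / PI * Im (Cln (disc_ratio cb sb 0))
    - (hm - hp) = - (hm - hp + h)).
  unfold ca, sa, cb, sb; rewrite !Cln_disc_ratio_0 by assumption; simpl.
  apply (Rmult_eq_reg_r PI); [field_simplify; lra | lra]. }
set (Q := fun z : C => (z * 0 + hm / PI * Cln (Csinh (z - (0, a)%R) / Csinh (z + (0, a)%R))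
   - hp / PI * Cln (Csinh (z - (0, b)%R) / Csinh (z + (0, b)%R)) - Ci * (hm - hp))%C).
change (biholomorphic_onto strip (Omega_tilde hm hp h) Q).
assert (HQ : forall z, strip z -> Q z = f (Cexp (2 * z))).
{ intros z Hz; unfold Q, f, disc_map; rewrite !sinh_ratio by assumption.
  unfold ca, sa, cb, sb; ring. }
destruct (strip_map_inverse hm hp ca sa cb sb Hca Hcb Hsa Hsb Hc hm_pos hp_pos H3
  h h_pos dam_pos Htip) as [g [Hg Dg]].
set (W := disc_of_strip ca cb).
assert (HW : forall p, pi_strip p -> half_disc (W p))
  by (intros p Hp; now apply (disc_of_strip_half_disc ca cb sb)).
split; [| split].
- intros z Hz; rewrite HQ by exact Hz.
  apply disc_map_into; try assumption; now apply strip_half_disc.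
- intros z Hz; assert (Hw := strip_half_disc z Hz).
  eapply cder_ex_derive, (cder_ext_loc (fun x => f (Cexp (2 * x)))).
  + generalize (strip_near z Hz); apply cnear_imp; intros y Hy; now rewrite HQ.
  + apply (cder_comp f (fun x => Cexp (2 * x))).
    * apply (cder_comp Cexp (fun x => 2 * x)%C); [apply cder_scal, cder_id | apply cder_Cexp].
    * apply cder_disc_map; try assumption; [now apply half_disc_closed | |];
        now apply half_disc_neq_unit.
- exists (fun z => (/ 2)%R * Cln (W (g z)))%C; repeat split.
  (* [repeat split] also opens [strip], so membership is proved once for each of its three
     inequalities. *)
  + apply half_Cln_strip, HW, Hg, H.
  + apply half_Cln_strip, HW, Hg, H.
  + apply half_Cln_strip, HW, Hg, H.
  + intros z Hz; destruct (Hg z Hz) as [Gs Ge], (Dg z Hz) as [l Dl].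
    eapply cder_ex_derive, cder_scal.
    apply (cder_comp Cln (fun x => W (g x))).
    * apply (cder_comp W g); [exact Dl |].
      now apply (cder_disc_of_strip ca sa cb sb).
    * now apply cder_Cln, half_disc_off_cut, HW.
  + intros z Hz; assert (Hw := strip_half_disc z Hz).
    rewrite HQ by exact Hz.
    assert (HO : Omega_tilde hm hp h (f (Cexp (2 * z)))) by now apply disc_map_into.
    destruct (Hg _ HO) as [Gs Ge].
    (* The strip coordinate of [Cexp (2 * z)]; injectivity of [strip_map] identifies it with the
       preimage chosen by [g]. *)
    set (p := Cln (disc_quot ca cb (Cexp (2 * z)))).
    assert (Hp : pi_strip p) by now apply (Cln_disc_quot_strip ca cb sb).
    assert (Ew : W p = Cexp (2 * z)) by now apply (disc_of_strip_Cln ca cb sb).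
    assert (Eg : g (f (Cexp (2 * z))) = p).
    { apply (strip_inj (strip_map hm hp ca sa cb sb) (strip_map_der hm ca sa cb)).
      - now apply cder_strip_map.
      - now apply (strip_map_der_Re hm ca sa cb sb).
      - exact Gs.
      - exact Hp.
      - rewrite Ge; unfold strip_map; fold W; now rewrite Ew. }
    rewrite Eg, Ew; now apply half_Cln_Cexp.
  + intros z Hz; destruct (Hg z Hz) as [Gs Ge].
    rewrite HQ by now apply half_Cln_strip, HW.
    rewrite Cexp_half_Cln by now apply HW.
    exact Ge.
Qed.
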